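(* Let $V$ be a finite non-empty set, $K$ a non-degenerate sub-stochastic matrix on $V$, $\lambda\in(0,\infty)$, and $\nu$ an admissible probability distribution on $V$. For any $\varepsilon\in(0,1/2)$, the $\mathrm{ARW}(K,\lambda,\nu)$ chain satisfies $$t_{\mathrm{sep}}(\varepsilon)-t_{\mathrm{sep}}(1-\varepsilon)\;\le\;\sqrt{\frac{8\,t_{\mathrm{rel}}\,t_{\mathrm{sep}}}{\varepsilon}}.$$ In particular, a sequence (indexed by $n\ge1$) of ARW chains exhibits separation cutoff if and only if $t_{\mathrm{rel}}^{(n)}=o\big(t_{\mathrm{sep}}^{(n)}\big)$ as $n\to\infty$.
   Context: $V$ is a finite set of sites. A sub-stochastic matrix on $V$ is a function $K\colon V^2\to[0,1]$ with $\sum_{y\in V}K(x,y)\le 1$ for all $x$; it is non-degenerate if no principal sub-matrix of $K$ is stochastic. A $K$-walk is the killed random walk which, when alive at $x$, jumps to $y\in V$ at rate $K(x,y)$ and is killed at rate $1-\sum_{y}K(x,y)$. The distribution $\nu$ is admissible if its support intersects every connected component of $K$, so that every site has a positive probability of being visited by a $K$-walk started from $\nu$. ARW dynamics: a configuration is $\eta\in\{0,\mathrm s,1,2,\ldots\}^V$; the site $x$ is empty if $\eta(x)=0$, holds one sleeping particle if $\eta(x)=\mathrm s$, and holds $k\ge1$ active particles if $\eta(x)=k$. In continuous time, active particles perform independent $K$-walks (a killed particle is removed), but fall asleep at rate $\lambda$ when alone on a site; sleeping particles do not move, but become active upon contact with another particle. Configurations in $\{0,\mathrm s\}^V$ are stable,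 and from any configuration with finitely many particles the process is almost surely absorbed in a stable configuration (stabilization). The $\mathrm{ARW}(K,\lambda,\nu)$ chain is the discrete-time Markov chain on $\mathcal X=\{0,\mathrm s\}^V$ which at each step adds one active particle to the current state at an independent $\nu$-distributed random site and then runs the ARW dynamics until a stable configuration is obtained; the latter is the new state. Its transition matrix $P$ is irreducible and aperiodic, with unique invariant distribution $\pi$. Relaxation time: $\rho:=\max\{|z|\colon z\in\mathbb C\setminus\{1\}\text{ is an eigenvalue of }P\}$, $t_{\mathrm{rel}}:=\frac1{1-\rho}$. Separation distance: $d_{\mathrm{sep}}(t):=\max_{\eta,\eta'\in\mathcal X}\big(1-\frac{P^t(\eta,\eta')}{\pi(\eta')}\big)$ for $t\in\mathbb N=\{0,1,2,\dots\}$. Separation mixing time: $t_{\mathrm{sep}}(\varepsilon):=\inf\{t\in\mathbb N\colon d_{\mathrm{sep}}(t)\le\varepsilon\}$ and $t_{\mathrm{sep}}:=t_{\mathrm{sep}}(1/2)$. A sequence of chains (quantities of the $n$-th chain carry the superscript $(n)$; the parameters $V_n,K_n,\lambda_n,\nu_n$ may all depend on $n$) exhibits separation cutoff if for any fixed $\alpha\ge0$, $d_{\mathrm{sep}}^{(n)}(\lfloor\alpha t_{\mathrm{sep}}^{(n)}\rfloor)$ tends, as $n\to\infty$, to $1$ if $\alpha<1$ and to $0$ if $\alpha>1$.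
   Formalization: The direction ''separation cutoff implies t_rel = o(t_sep)'' is stated under the extra assumption that t_sep^(n) tends to infinity; without it the claim fails for the constant sequence V={x}, K=0, where cutoff holds but t_rel = t_sep = 1. *)

(* Defs.v *)
(* MathComp / MathComp-Analysis, over an arbitrary R : realType. *)
From HB Require Import structures.
From mathcomp Require Import all_boot all_order all_algebra.
From mathcomp Require Import complex.
From mathcomp Require Import all_classical all_reals all_analysis.
Import Order.TTheory GRing.Theory Num.Theory.
Import numFieldNormedType.Exports.

Set Implicit Arguments.
Unset Strict Implicit.
Unset Printing Implicit Defensive.

Local Open Scope classical_set_scope.
Local Open Scope ring_scope.

Section Setting.
Variables (R : realType) (V : finType).
Implicit Types (K : V -> V -> R) (nu : V -> R).

Definition substochastic K : Prop :=
  (forall x y, 0 <= K x y <= 1) /\ (forall x, \sum_y K x y <= 1).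

Definition nondegenerate_kernel K : Prop :=
  forall A : {set V}, A != finset.set0 ->
    ~ (forall x, x \in A -> \sum_(y in A) K x y = 1).

Definition prob_distribution nu : Prop :=
  (forall x, 0 <= nu x) /\ \sum_x nu x = 1.

(* K is not assumed symmetric, so connectedness is oriented: every site must be
   reachable from the support of nu along transitions of positive rate, i.e. it
   is visited with positive probability by a K-walk started from nu. *)
Definition admissible K nu : Prop :=
  forall y, exists2 x, 0 < nu x & connect (fun u v => 0 < K u v) x y.

End Setting.

Section Configurations.
Variable V : finType.

(* None: one sleeping particle; Some k: k active particles (Some 0: empty). *)
Definition site_state := option nat.
Definition conf := {ffun V -> site_state}.
Implicit Types (eta : conf) (x : V).

Definition nactive (s : site_state) : nat := odflt 0%N s.

Definition set_site eta x (s : site_state) : conf :=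
  [ffun z => if z == x then s else eta z].

(* An incoming active particle wakes up the sleeping particle it meets. *)
Definition arrive eta x : conf :=
  set_site eta x (if eta x is Some k then Some k.+1 else Some 2%N).

(* Only used at sites with at least one active particle. *)
Definition depart eta x : conf := set_site eta x (omap predn (eta x)).

Definition fall_asleep eta x : conf := set_site eta x None.

(* A stable configuration is identified with the set of its occupied sites. *)
Definition stable_conf (S : {set V}) : conf :=
  [ffun x => if x \in S then None else Some 0%N].

End Configurations.

Section Dynamics.
Variables (R : realType) (V : finType) (K : V -> V -> R) (lambda : R).
Implicit Types (f : conf V -> R) (eta : conf V).

(* Infinitesimal generator of the continuous-time dynamics. *)
Definition generator f eta : R :=
  \sum_x
    ((nactive (eta x))%:R *
       (\sum_y K x y * (f (arrive (depart eta x) y) - f eta)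
        + (1 - \sum_y K x y) * (f (depart eta x) - f eta))
     + (if eta x == Some 1%N then lambda * (f (fall_asleep eta x) - f eta)
        else 0)).

(* The transition semigroup exp(tL), L being the generator: it maps f to
   eta |-> E_eta[f(eta_t)]. The number of particles never increases, so only
   finitely many configurations are accessible from eta and the exponential
   series converges. *)
Definition semigroup (t : R) f eta : R :=
  limn (series (fun k => t ^+ k / k`!%:R * iter k generator f eta)).

(* Probability that the dynamics started from eta is absorbed in the stable
   configuration S. *)
Definition stabilization eta (S : {set V}) : R :=
  lim (semigroup t (fun xi => (xi == stable_conf S)%:R) eta @[t --> +oo]).

End Dynamics.

(* Transition matrix of the ARW(K, lambda, nu) chain; the stable configurations
   are numbered by enum_val. *)
Definition arw_matrix (R : realType) (V : finType) (K : V -> V -> R)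
    (lambda : R) (nu : V -> R) : 'M[R]_#|{set V}| :=
  \matrix_(i, j) \sum_x nu x *
    stabilization K lambda (arrive (stable_conf (enum_val i)) x) (enum_val j).

Section MarkovChains.
Variables (R : realType) (n : nat) (P : 'M[R]_n).

Definition invariant_distribution (mu : 'rV[R]_n) : Prop :=
  [/\ forall j, 0 <= mu 0 j, \sum_j mu 0 j = 1 & mu *m P = mu].

(* The invariant distribution, when it is unique. *)
Definition stationary : 'rV[R]_n :=
  xget 0 [set mu | invariant_distribution mu].

(* The maxima are written as suprema (of finite sets). *)
Definition rho : R :=
  sup [set complex.Re `|z| | z in
    [set z : R[i] | z != 1 /\ eigenvalue (map_mx (real_complex R) P) z]].

Definition t_rel : R := (1 - rho)^-1.

Definition d_sep (t : nat) : R :=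
  sup [set 1 - (P ^+ t) ij.1 ij.2 / stationary 0 ij.2 | ij in
    [set: 'I_n * 'I_n]].

Definition t_sep (eps : R) : R :=
  inf [set t%:R | t in [set t : nat | d_sep t <= eps]].

End MarkovChains.

Definition separation_cutoff (R : realType) (N : nat -> nat)
    (P : forall n, 'M[R]_(N n)) : Prop :=
  forall alpha : R, 0 <= alpha ->
    (alpha < 1 ->
       d_sep (P n) (Num.truncn (alpha * t_sep (P n) 2^-1)) @[n --> \oo] --> (1 : R))
    /\
    (1 < alpha ->
       d_sep (P n) (Num.truncn (alpha * t_sep (P n) 2^-1)) @[n --> \oo] --> (0 : R)).

(* Main.v *)
(** By the abelian property, the state after [t] steps is obtained by adding [t] active
    particles at once and stabilizing in any order.  Let the particles first perform
    internal DLA, settling at the first free site; once the cluster fills [V], at time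
    [T], stabilizing gives exactly the invariant law, whatever the initial state.  Before
    [T] there are not enough particles to reach the full configuration, whence
    [d_sep t = P(T > t)] for [T] started from the empty cluster.

    An extra initial particle shortens [E T] by at most the time to hit a single site [z],
    a geometric time whose failure probability is an eigenvalue of the chain, hence by at
    most [t_rel].  Summing the conditional variances of the Doob martingale of [T] gives
    [Var T <= t_rel * E T], and Chebyshev's inequality together with [E T <= 2 t_sep]
    bounds the window.  Conversely every eigenvalue [z <> 1] satisfies
    [|z| ^ t <= d_sep t], which makes [t_rel = o(t_sep)] necessary. *)
Require Import Defs.
From HB Require Import structures.
From mathcomp Require Import all_boot all_order all_algebra.
From mathcomp Require Import complex.
From mathcomp Require Import all_classical all_reals all_analysis.
From mathcomp Require Import ring lra zify.
Import Order.TTheory GRing.Theory Num.Theory.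
Import numFieldNormedType.Exports.
Local Open Scope classical_set_scope.
Local Open Scope ring_scope.

Set Implicit Arguments.
Unset Strict Implicit.
Unset Printing Implicit Defensive.

(** * Sub-stochastic kernels *)

(** No probability space is built. Exit laws and the mean and variance of [T] are solutions of
    linear equations [f = b + K f], and couplings become comparisons with sub- or supersolutions.
    Two uniqueness principles carry this: the minimum principle for non-degenerate sub-stochastic
    kernels and, on the infinite space of configurations, the fact that a bounded function invariant
    under legal topplings is determined by its values at stable configurations. The obstacle is that
    the chain is defined by the semigroup of a generator with unbounded rates. [absorb], built from
    discrete topplings in no prescribed order, has to be identified with the limit of that
    semigroup; this is done by uniformization, at a rate depending on the initial number of
    particles. The constant 8 is [4 * 2]: two deviations of size at most [sqrt (Var T / eps)] make a
    squared window of at most [4 * Var T / eps], and the factor 2 comes from the bound on [E T]. *)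

Section Kernel.
Variables (R : realType) (W : finType) (K : W -> W -> R).
Hypotheses (Ksub : substochastic K) (Knd : nondegenerate_kernel K).

Let K_ge0 x y : 0 <= K x y. Proof. by have /andP[] := Ksub.1 x y. Qed.

(** If the minimum were negative, averaging at a minimizer would force row sum 1 with all mass on
    minimizers, so the set of minimizers would carry a stochastic principal sub-matrix. *)
Lemma min_principle (f : W -> R) :
  (forall x, \sum_y K x y * f y <= f x) -> forall x, 0 <= f x.
Proof.
move=> fK x0; rewrite leNgt; apply/negP => fx0.
have [xm _ fmin] := arg_minP f (erefl true : xpredT x0).
set m := f xm in fmin; have m0 : m < 0 by apply: le_lt_trans (fmin x0 _) fx0.
apply: (Knd (A := [set x | f x == m]%SET)).
  by apply/set0Pn; exists xm; rewrite inE.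
move=> x; rewrite inE => /eqP fx.
have ge0 y : 0 <= K x y * (f y - m) by rewrite mulr_ge0// subr_ge0 fmin.
have sumE : \sum_y K x y * (f y - m) = \sum_y K x y * f y - m * \sum_y K x y.
  rewrite mulr_sumr -sumrB; apply: eq_bigr => y _.
  by rewrite mulrBr (mulrC m).
have K1 := Ksub.2 x.
have sum_ge0 : 0 <= \sum_y K x y * (f y - m) by apply: sumr_ge0.
have sum_le : \sum_y K x y * (f y - m) <= m * (1 - \sum_y K x y).
  by rewrite sumE mulrBr mulr1 lerD2r -fx.
have K1' : \sum_y K x y = 1 by nra.
have /eqP : \sum_y K x y * (f y - m) = 0.
  by apply/eqP; rewrite eq_le sum_ge0 (le_trans sum_le)// K1' subrr mulr0.
rewrite psumr_eq0// => /allP sum0.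
rewrite -K1' [RHS](bigID (mem [set x | f x == m]%SET))/= [X in _ + X]big1 ?addr0//.
move=> y; rewrite inE => fy.
have := sum0 y (mem_index_enum _); rewrite mulf_eq0 subr_eq0 (negPf fy) orbF.
by move/eqP.
Qed.

Lemma max_principle (f g : W -> R) :
    (forall x, f x - g x <= \sum_y K x y * (f y - g y)) ->
  forall x, f x <= g x.
Proof.
move=> fg x; rewrite -subr_ge0; move: x; apply: min_principle => x.
rewrite -[leRHS]opprB -[leLHS]opprK lerN2 -sumrN (le_trans (fg x))//.
by apply: ler_sum => y _; rewrite -mulrN opprB.
Qed.

Lemma kernel_eq (b f g : W -> R) :
    (forall x, f x = b x + \sum_y K x y * f y) ->
    (forall x, g x = b x + \sum_y K x y * g y) ->
  f =1 g.
Proof.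
move=> fE gE x; apply/le_anti/andP; split; move: x; apply: max_principle => x;
  by rewrite fE gE opprD addrACA subrr add0r -sumrB; apply: ler_sum => y _;
    rewrite mulrBr.
Qed.

(** Uniqueness ([kernel_eq]) makes [1 - K] injective, hence invertible in finite dimension. The sig
    type lets exit laws and moments be defined as solutions. *)
Lemma kernel_solve (b : W -> R) :
  {f : W -> R | forall x, f x = b x + \sum_y K x y * f y}.
Proof.
(* Transposed, because functions are encoded as row vectors. *)
pose M : 'M[R]_#|W| :=
  \matrix_(i, j) ((i == j)%:R - K (enum_val j) (enum_val i)).
have MK (v : 'rV_#|W|) x : (v *m M) 0 (enum_rank x) =
    v 0 (enum_rank x) - \sum_y K x y * v 0 (enum_rank y).
  rewrite mxE; under eq_bigr do rewrite mxE mulrBr.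
  rewrite sumrB; congr (_ - _).
    rewrite (bigD1 (enum_rank x))//= eqxx mulr1 big1 ?addr0// => i /negPf ->.
    by rewrite mulr0.
  rewrite (reindex (@enum_rank W))/=; last first.
    by exists enum_val => i _; [exact: enum_rankK|exact: enum_valK].
  by apply: eq_bigr => y _; rewrite !enum_rankK mulrC.
have Mu : M \in unitmx.
  rewrite -row_free_unit; apply: inj_row_free => v vM0.
  apply/rowP => i; rewrite -(enum_valK i) [RHS]mxE.
  move: (enum_val i); apply: (@kernel_eq (fun=> 0)) => x; rewrite add0r.
    by apply/eqP; rewrite -subr_eq0 -MK vM0 mxE.
  by rewrite big1// => y _; rewrite mulr0.
pose v := (\row_i b (enum_val i)) *m invmx M.
exists (fun x => v 0 (enum_rank x)) => x.
by apply/eqP; rewrite -subr_eq -MK mulmxKV// mxE enum_rankK.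
Qed.

End Kernel.

(** * Topplings *)

Section Instructions.
Variable V : finType.
Implicit Types (eta xi : conf V) (i j : option (option V)).

Definition active eta (x : V) : bool := (0 < nactive (eta x))%N.

(* [None] is sleep, [Some None] is death, [Some (Some z)] is a jump to [z].  Letting sleep
   instructions have no effect on a site with several particles is what makes topplings
   at distinct sites commute. *)
Definition act (x : V) i eta : conf V :=
  match i with
  | None => if eta x == Some 1%N then fall_asleep eta x else eta
  | Some None => depart eta x
  | Some (Some z) => arrive (depart eta x) z
  end.

Lemma arriveE eta x u : arrive eta x u =
  if u == x then (if eta x is Some k then Some k.+1 else Some 2%N) else eta u.
Proof. by rewrite ffunE. Qed.

Lemma departE eta x u :
  depart eta x u = if u == x then omap predn (eta x) else eta u.
Proof. by rewrite ffunE. Qed.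

Lemma actE x i eta u : act x i eta u =
  let s := if u == x then
             if i == None then if eta x == Some 1%N then None else eta x
             else omap predn (eta x)
           else eta u in
  if i == Some (Some u) then (if s is Some k then Some k.+1 else Some 2%N) else s.
Proof.
case: i => [[z|]|] /=; last 1 first.
- have [->|ux] := eqVneq u x; case: ifP => //; rewrite ffunE ?eqxx//.
  by rewrite (negPf ux).
- rewrite arriveE !(inj_eq Some_inj) [z == u]eq_sym departE.
  by case: eqP => [->|]; rewrite ?departE.
- by rewrite departE.
Qed.

Lemma act_active x y i eta : x != y -> active eta y -> active (act x i eta) y.
Proof.
move=> xy; rewrite /active actE eq_sym (negPf xy) /=.
by case: ifP => // _; case: (eta y).
Qed.

(** The delicate case is a lone particle at [x] that gets a sleep instruction and a visitor: asleep
    and then woken, or visited first so that the sleep is void, the site ends with two active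
    particles. *)
Lemma act_comm x y i j eta : x != y -> active eta x -> active eta y ->
  act x i (act y j eta) = act y j (act x i eta).
Proof.
move=> xy; rewrite /active.
have yx : (y == x) = false by rewrite eq_sym (negPf xy).
move/negPf in xy.
case ex: (eta x) => [[//|k]|//] _; case ey: (eta y) => [[//|l]|//] _.
apply/ffunP => u; rewrite !actE /= xy yx ex ey.
have [->|ux] := eqVneq u x.
  rewrite ?xy ?ex; case: (i == None) => /=; case: (j == Some (Some x)) => //=;
  case: (i == Some (Some x)) => //=; case: k {ex} => [|k] //=.
have [->|uy] := eqVneq u y.
  rewrite ?yx ?ey; case: (j == None) => /=; case: (i == Some (Some y)) => //=;
  case: (j == Some (Some y)) => //=; case: l {ey} => [|l] //=.
by case: (i == _); case: (j == _).
Qed.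

Lemma act_arrive x y i eta : active eta x ->
  act x i (arrive eta y) = arrive (act x i eta) y.
Proof.
rewrite /active; case ex: (eta x) => [[//|k]|//] _.
apply/ffunP => u; rewrite !(actE, arriveE) ex.
have [->|ux] := eqVneq u x.
  rewrite ?ex [x == y]eq_sym; have [->|yx] := eqVneq y x; rewrite ?ex ?eqxx /=.
    by case: (i == None) => /=; case: (i == _) => //=; case: k {ex}.
  by [].
have [uy|uy] := eqVneq u y; last by [].
by rewrite uy -uy (negPf ux) /=; case: (i == _); case: (eta u).
Qed.

Lemma depart_arrive eta x : eta x != None -> depart (arrive eta x) x = eta.
Proof.
move=> ex; apply/ffunP => y; rewrite !ffunE eqxx.
by case: eqP => [->|//]; case: (eta x) ex.
Qed.

Lemma active_neq0 eta x : active eta x -> eta x != None.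
Proof. by rewrite /active; case: (eta x). Qed.

Lemma sleep_arrive eta x : active eta x -> act x None (arrive eta x) = arrive eta x.
Proof.
rewrite /active /= arriveE eqxx => ax; case: eqP => //.
by case: (eta x) ax => [[]|].
Qed.

Definition act_conf (A : {set V}) : conf V := [ffun x => Some (x \in A : nat)].

Lemma act_conf_active (A : {set V}) x : active (act_conf A) x = (x \in A).
Proof. by rewrite /active ffunE; case: (x \in A). Qed.

Lemma arrive_act_conf (A : {set V}) x : x \notin A -> arrive (act_conf A) x = act_conf (x |: A).
Proof.
move=> xA; apply/ffunP => y; rewrite !ffunE !inE.
by case: eqP => [->|]; rewrite ?(negPf xA).
Qed.

Lemma act_conf0 : act_conf finset.set0 = stable_conf finset.set0.
Proof. by apply/ffunP => x; rewrite !ffunE !inE. Qed.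

Definition count eta : nat :=
  (\sum_x (if eta x is Some k then k else 1))%N.

Lemma count_set_site eta x s :
  (count (set_site eta x s) + (if eta x is Some k then k else 1)
   = count eta + (if s is Some k then k else 1))%N.
Proof.
rewrite /count (bigD1 x)//= [in RHS](bigD1 x)//= ffunE eqxx.
under eq_bigr => y yx do rewrite ffunE (negPf yx).
by rewrite addnC [X in (_ + X = _)%N]addnC addnA.
Qed.

Lemma count_arrive eta x : (count (arrive eta x) = (count eta).+1)%N.
Proof.
have := count_set_site eta x (if eta x is Some k then Some k.+1 else Some 2%N).
by rewrite /arrive; case: (eta x) => [k|]; lia.
Qed.

Lemma count_depart eta x : active eta x ->
  (count eta = (count (depart eta x)).+1)%N.
Proof.
rewrite /active; have := count_set_site eta x (omap predn (eta x)).
by rewrite /depart; case: (eta x) => [[//|k]|//] /=; lia.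
Qed.

Lemma count_act x i eta : active eta x -> (count (act x i eta) <= count eta)%N.
Proof.
move=> ax; case: i => [[z|]|] /=; last first.
  case: ifPn => // /eqP ex; have := count_set_site eta x None.
  by rewrite ex /fall_asleep /=; lia.
all: by rewrite ?count_arrive (count_depart ax).
Qed.

Lemma count_stable (S : {set V}) : count (stable_conf S) = #|S|.
Proof.
rewrite /count -sum1_card [RHS]big_mkcond; apply: eq_bigr => x _.
by rewrite ffunE; case: ifP.
Qed.

Lemma stable_active (S : {set V}) x : active (stable_conf S) x = false.
Proof. by rewrite /active ffunE; case: ifP. Qed.

Lemma stable_conf_inj : injective (@stable_conf V).
Proof.
move=> S T /ffunP ST; apply/setP => x; have := ST x; rewrite !ffunE.
by do 2 case: ifP.
Qed.

Lemma stableP eta :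
  reflect (exists S, eta = stable_conf S) [forall x, ~~ active eta x].
Proof.
apply: (iffP forallP) => [na|[S ->] x]; last by rewrite stable_active.
exists [set x | eta x == None]%SET; apply/ffunP => x; rewrite ffunE inE.
by have := na x; rewrite /active; case: (eta x) => [[|k]|].
Qed.

End Instructions.

(** * Random topplings at a site *)

Section Topple.
Variables (R : realType) (V : finType) (K : V -> V -> R) (lambda : R).
Hypotheses (Ksub : substochastic K) (lambda_gt0 : 0 < lambda).
Implicit Types (f g : conf V -> R) (eta xi : conf V) (i j : option (option V)).

(** Each active particle jumps or dies at total rate 1 and receives sleep instructions at rate
    [lambda], effective or not. *)
Definition weight (x : V) i : R :=
  match i with
  | None => lambda / (1 + lambda)
  | Some None => (1 - \sum_y K x y) / (1 + lambda)
  | Some (Some z) => K x z / (1 + lambda)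
  end.

Definition topple (x : V) f eta : R := \sum_i weight x i * f (act x i eta).

Lemma sum_option (T : finType) (F : option T -> R) :
  \sum_i F i = F None + \sum_t F (Some t).
Proof.
rewrite (bigD1 None)//=; congr (_ + _).
rewrite (reindex_omap Some id) /=; last by case.
by apply: eq_bigl => t; rewrite eqxx.
Qed.

Lemma toppleE x f eta : topple x f eta = (1 + lambda)^-1 *
  (\sum_y K x y * f (arrive (depart eta x) y)
   + (1 - \sum_y K x y) * f (depart eta x)
   + lambda * f (act x None eta)).
Proof.
rewrite /topple !sum_option !mulrDr addrC; congr (_ + _); last first.
  by rewrite mulrA (mulrC _ lambda).
rewrite addrC; congr (_ + _); last by rewrite /= mulrA (mulrC _^-1).
by rewrite mulr_sumr; apply: eq_bigr => y _; rewrite /= mulrA (mulrC _^-1).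
Qed.

Lemma lambda1_gt0 : 0 < 1 + lambda. Proof. by rewrite addr_gt0. Qed.

Lemma weight_ge0 x i : 0 <= weight x i.
Proof.
have l1 := ltW lambda1_gt0.
case: i => [[z|]|] /=; apply: divr_ge0 => //; last exact: ltW.
- by have /andP[] := Ksub.1 x z.
- by rewrite subr_ge0 Ksub.2.
Qed.

Lemma sum_weight x : \sum_i weight x i = 1.
Proof.
rewrite !sum_option /= -mulr_suml -!mulrDl subrK (addrC lambda) divff//.
by rewrite gt_eqF// lambda1_gt0.
Qed.

Lemma ler_topple x f g eta :
  (forall i, f (act x i eta) <= g (act x i eta)) ->
  topple x f eta <= topple x g eta.
Proof.
by move=> fg; apply: ler_sum => i _; rewrite ler_wpM2l ?weight_ge0.
Qed.

Lemma eq_topple x f g eta :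
  (forall i, f (act x i eta) = g (act x i eta)) ->
  topple x f eta = topple x g eta.
Proof. by move=> fg; apply: eq_bigr => i _; rewrite fg. Qed.

Lemma topple_cst x c eta : topple x (fun=> c) eta = c.
Proof. by rewrite /topple -mulr_suml sum_weight mul1r. Qed.

Lemma toppleB x f g eta :
  topple x (fun xi => f xi - g xi) eta = topple x f eta - topple x g eta.
Proof. by rewrite -sumrB; apply: eq_bigr => i _; rewrite mulrBr. Qed.

Lemma toppleZ x c f eta :
  topple x (fun xi => c * f xi) eta = c * topple x f eta.
Proof. by rewrite mulr_sumr; apply: eq_bigr => i _; rewrite mulrCA. Qed.

Lemma topple_sum (I : Type) (r : seq I) (P : pred I) (F : I -> conf V -> R)
    x eta :
  topple x (fun xi => \sum_(k <- r | P k) F k xi) eta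
  = \sum_(k <- r | P k) topple x (F k) eta.
Proof.
rewrite exchange_big/=; apply: eq_bigr => i _; by rewrite mulr_sumr.
Qed.

Lemma topple_norm x f eta :
  `|topple x f eta| <= topple x (fun xi => `|f xi|) eta.
Proof.
rewrite (le_trans (ler_norm_sum _ _ _))//; apply: ler_sum => i _.
by rewrite normrM (ger0_norm (weight_ge0 _ _)).
Qed.

(** Void sleep instructions at sites with several particles cost nothing, so every active particle
    may be given the same rate [1 + lambda]. *)
Lemma generatorE f eta : generator K lambda f eta =
  \sum_x (nactive (eta x))%:R * (1 + lambda) * (topple x f eta - f eta).
Proof.
have l1 : 1 + lambda != 0 by rewrite gt_eqF// lambda1_gt0.
apply: eq_bigr => x _; rewrite -[RHS]mulrA [X in _ = _ * X]mulrBr toppleE mulVKf//=.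
set k := nactive _; set a := \sum_y K x y * f _; set b := \sum_y K x y.
have -> : \sum_y K x y * (f (arrive (depart eta x) y) - f eta) = a - b * f eta.
  by rewrite mulr_suml -sumrB; apply: eq_bigr => y _; rewrite mulrBr.
case: eqP => [ex|_]; last by rewrite addr0; congr (_ * _); ring.
by rewrite /k ex /= !mul1r; ring.
Qed.

Lemma topple_comm x y f eta : x != y -> active eta x -> active eta y ->
  topple x (topple y f) eta = topple y (topple x f) eta.
Proof.
move=> xy ax ay; rewrite /topple.
under eq_bigr do rewrite mulr_sumr.
under [RHS]eq_bigr do rewrite mulr_sumr.
rewrite exchange_big/=; apply: eq_bigr => i _; apply: eq_bigr => j _.
by rewrite mulrCA act_comm// eq_sym.
Qed.

Lemma topple_arrive x y f eta : active eta x ->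
  topple x f (arrive eta y) = topple x (fun xi => f (arrive xi y)) eta.
Proof. by move=> ax; apply: eq_bigr => i _; rewrite act_arrive. Qed.

End Topple.

(** * The abelian property *)

Lemma cvg_sumr (R : realType) (I T : Type) (F : set_system T) (FF : Filter F)
    (r : seq I) (P : pred I) (f : I -> T -> R) (a : I -> R) :
    (forall i, f i x @[x --> F] --> a i) ->
  \sum_(i <- r | P i) f i x @[x --> F] --> \sum_(i <- r | P i) a i.
Proof.
move=> fa; elim: r => [|i r IH].
  by under eq_cvg do rewrite big_nil; rewrite big_nil; exact: cvg_cst.
under eq_cvg do rewrite big_cons; rewrite big_cons.
by case: (P i) => //; apply: cvgD.
Qed.

Section Abelian.
Variables (R : realType) (V : finType) (K : V -> V -> R) (lambda : R).
Hypotheses (Ksub : substochastic K) (Knd : nondegenerate_kernel K).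
Hypothesis lambda_gt0 : 0 < lambda.
Implicit Types (f g : conf V -> R) (eta xi : conf V) (S : {set V}).

Local Notation T := (topple K lambda).

(* Largest probability of being stabilized in [S] by at most [k] topplings, over
   all toppling strategies. *)
Fixpoint best S k eta : R :=
  if k is k'.+1 then
    \big[Num.max/best S k' eta]_(x | active eta x) T x (best S k') eta
  else (eta == stable_conf S)%:R.

Lemma bestS_ge S k eta : best S k eta <= best S k.+1 eta.
Proof. exact: bigmax_ge_id. Qed.

Lemma topple_best_le S k eta x : active eta x ->
  T x (best S k) eta <= best S k.+1 eta.
Proof. by move=> ax; rewrite /= (bigD1 x)//= le_max lexx. Qed.

Lemma best_bounds S k eta : 0 <= best S k eta <= 1.
Proof.
elim: k eta => [|k IH] eta; first by rewrite /=; case: eqP; rewrite ler01 lexx.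
rewrite (le_trans _ (bestS_ge S k eta)) ?(andP (IH _)).1//=.
apply: bigmax_le => [|x ax]; first by case/andP: (IH eta).
rewrite -[leRHS](topple_cst K lambda_gt0 x 1 eta).
by apply: ler_topple => // i; case/andP: (IH (act x i eta)).
Qed.

Lemma best_stable S k S' : best S k (stable_conf S') = (S' == S)%:R.
Proof.
elim: k => [|k IH] /=; first by rewrite (inj_eq (@stable_conf_inj V)).
by rewrite big_pred0 // => x; rewrite stable_active.
Qed.

Lemma best_count S k eta : (count eta < #|S|)%N -> best S k eta = 0.
Proof.
elim: k eta => [|k IH] eta cS /=.
  by case: eqP => // etaS; rewrite etaS count_stable ltnn in cS.
rewrite (eq_bigr (fun=> 0)) => [|x ax].
  by rewrite IH//; elim/big_ind: _ => // a b -> ->; rewrite maxxx.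
rewrite -[RHS](topple_cst K lambda_gt0 x 0 eta); apply: eq_topple => i.
by rewrite IH// (leq_ltn_trans (count_act _ _)).
Qed.

(* Since topplings at distinct sites commute, an optimal strategy may always be
   postponed until after any given legal toppling. *)
Lemma best_le_topple S k eta x : active eta x ->
  best S k eta <= T x (best S k) eta.
Proof.
elim: k eta x => [|k IH] eta x ax.
  rewrite /=; case: eqP => [etaS|_]; first by rewrite etaS stable_active in ax.
  rewrite -[leLHS](topple_cst K lambda_gt0 x 0 eta).
  by apply: ler_topple => // i.
have mono : T x (best S k) eta <= T x (best S k.+1) eta.
  by apply: ler_topple => // i; exact: bestS_ge.
apply: bigmax_le => [|y ay]; first exact: le_trans (IH _ _ ax) mono.
have [->//|yx] := eqVneq y x.
(* The strategy starts at [y]: by induction the toppling at [x] is inserted right after it, and then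
   the two are exchanged. *)
apply: (@le_trans _ _ (T y (T x (best S k)) eta)).
  by apply: ler_topple => // i; apply: IH; exact: act_active.
rewrite topple_comm//; apply: ler_topple => // i.
by apply: topple_best_le; rewrite act_active// eq_sym.
Qed.

Definition absorb eta S : R := limn (fun k => best S k eta).

Lemma best_cvg S eta : best S k eta @[k --> \oo] --> absorb eta S.
Proof.
apply: nondecreasing_is_cvgn; first by apply/nondecreasing_seqP=> k; exact: bestS_ge.
by exists 1 => _ [k _ <-]; case/andP: (best_bounds S k eta).
Qed.

Lemma absorb_bounds S eta : 0 <= absorb eta S <= 1.
Proof.
apply/andP; split.
  by apply: limr_ge; [exact: best_cvg|near=> k; case/andP: (best_bounds S k eta)].
by apply: limr_le; [exact: best_cvg|near=> k; case/andP: (best_bounds S k eta)].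
Unshelve. all: by end_near. Qed.

Lemma absorb_stable S S' : absorb (stable_conf S') S = (S' == S)%:R.
Proof.
rewrite /absorb; under eq_fun do rewrite best_stable.
exact: lim_cst.
Qed.

Lemma absorb_count S eta : (count eta < #|S|)%N -> absorb eta S = 0.
Proof.
move=> cS; rewrite /absorb; under eq_fun do rewrite (best_count _ cS).
exact: lim_cst.
Qed.

(** Toppling [x] and then playing optimally is a strategy with one more step, while postponing the
    strategy after [x] loses nothing; in the limit both bounds agree. *)
Lemma absorb_topple S eta x : active eta x ->
  T x (absorb^~ S) eta = absorb eta S.
Proof.
move=> ax.
have cT : T x (best S k) eta @[k --> \oo] --> T x (absorb^~ S) eta.
  by apply: cvg_sumr => i; apply: cvgMr; exact: best_cvg.
have cS : best S k.+1 eta @[k --> \oo] --> absorb eta S.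
  by rewrite (cvg_shiftS (best S ^~ eta)); exact: best_cvg.
apply/le_anti/andP; split.
  apply: ler_cvg_to cT cS _; near=> k; exact: topple_best_le.
apply: ler_cvg_to (@best_cvg S eta) cT _; near=> k; exact: best_le_topple.
Unshelve. all: by end_near. Qed.

(** [G x] is the mean lifetime, in jumps, of a [K]-walk from [x], and [Phi] sums [G] over all
    particles. A toppling lowers [Phi] by [1 / (1 + lambda)] on average; since [Phi] is bounded on
    configurations of at most [N] particles, this is also a contraction. *)
Lemma lyapunov : exists2 Phi : conf V -> R,
    forall eta, 0 <= Phi eta /\ forall x, active eta x -> 1 <= Phi eta
  & forall N, exists2 theta : R, 0 <= theta < 1 &
    forall eta x, (count eta <= N)%N -> active eta x ->
      T x Phi eta <= theta * Phi eta.
Proof.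
have [G GE] := kernel_solve Ksub Knd (fun=> 1).
have G_ge0 x : 0 <= G x.
  move: x; apply: (min_principle Ksub Knd) => x.
  by rewrite [leRHS]GE lerDr.
have G_ge1 x : 1 <= G x.
  rewrite GE lerDl sumr_ge0// => y _; rewrite mulr_ge0//.
  by have /andP[] := Ksub.1 x y.
pose cnt (s : site_state) : nat := if s is Some k then k else 1%N.
pose Phi eta := \sum_x (cnt (eta x))%:R * G x.
have Phi_set eta x s :
    Phi (set_site eta x s) = Phi eta + ((cnt s)%:R - (cnt (eta x))%:R) * G x.
  rewrite /Phi (bigD1 x)//= [in RHS](bigD1 x)//= ffunE eqxx.
  under eq_bigr => y yx do rewrite ffunE (negPf yx).
  by ring.
have Phi_arrive eta x : Phi (arrive eta x) = Phi eta + G x.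
  rewrite Phi_set; congr (_ + _); rewrite -[RHS]mul1r; congr (_ * _).
  by case: (eta x) => [k|] /=; rewrite -?natr1; ring.
have Phi_depart eta x : active eta x -> Phi (depart eta x) = Phi eta - G x.
  rewrite /active Phi_set; case: (eta x) => [[//|k]|//] _ /=; rewrite -natr1.
  by ring.
have Phi_sleep eta x : Phi (act x None eta) = Phi eta.
  rewrite /=; case: eqP => // ex.
  by rewrite Phi_set ex subrr mul0r addr0.
have Phi_topple eta x : active eta x ->
    T x Phi eta = Phi eta - (1 + lambda)^-1.
  move=> ax; rewrite toppleE Phi_sleep Phi_depart//.
  under eq_bigr => y _ do rewrite Phi_arrive Phi_depart// mulrDr.
  rewrite big_split/= -mulr_suml.
  have := GE x; set S1 := \sum_y K x y; set S2 := \sum_y _ => GxE.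
  have l1 : 1 + lambda != 0 by rewrite gt_eqF// addr_gt0.
  have -> : S2 = G x - 1 by rewrite GxE [1 + _]addrC addrK.
  by apply: (mulfI l1); rewrite mulVKf// [RHS]mulrBr divff//; ring.
exists Phi => [eta|N].
  have Phi_ge0 : 0 <= Phi eta by apply: sumr_ge0 => x _; rewrite mulr_ge0.
  split=> // x ax; rewrite /Phi (bigD1 x)//= ler_wpDr//.
    by apply: sumr_ge0 => y _; rewrite mulr_ge0.
  rewrite mulr_ege1// ler1n; move: ax.
  by rewrite /active; case: (eta x) => [[]|].
(* [N.+1] rather than [N] keeps [B >= 1] when [N = 0]. *)
pose B := N.+1%:R * \sum_x G x.
have PhiB eta : (count eta <= N)%N -> Phi eta <= B.
  move=> cN; rewrite /B mulr_sumr; apply: ler_sum => x _.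
  rewrite ler_wpM2r// ler_nat (leq_trans _ (leqW cN))//.
  by rewrite /count (bigD1 x)//= leq_addr.
have [x0|V0] := pickP (mem V); last first.
  by exists 0; [rewrite lexx ltr01|move=> eta x; have := V0 x].
have B_ge1 : 1 <= B.
  rewrite mulr_ege1 ?ler1n// (bigD1 x0)//= ler_wpDr//.
  by apply: sumr_ge0 => y _.
have B_gt0 : 0 < B by apply: lt_le_trans B_ge1.
have l1 : 1 <= 1 + lambda by rewrite lerDl ltW.
exists (1 - (1 + lambda)^-1 / B).
  rewrite subr_ge0 ltrBlDr ltrDl divr_gt0 ?invr_gt0 ?(lt_le_trans ltr01)// andbT.
  by rewrite ler_pdivrMr// mul1r (le_trans _ B_ge1)// invf_le1// (lt_le_trans ltr01).
move=> eta x cN ax; rewrite Phi_topple// mulrBl mul1r lerD2l lerN2.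
rewrite -mulrA ler_piMr ?invr_ge0 ?(le_trans ler01)// ler_pdivrMl// mulr1.
exact: PhiB.
Qed.

(** Topplings never increase the number of particles, so one factor [theta] serves at every step:
    after [n] topplings the difference is at most [M * theta ^+ n * Phi], being zero once stable. *)
Lemma harmonic_eq f g (M : R) :
    (forall eta, `|f eta - g eta| <= M) ->
    (forall eta x, active eta x -> T x f eta = f eta) ->
    (forall eta x, active eta x -> T x g eta = g eta) ->
    (forall S, f (stable_conf S) = g (stable_conf S)) ->
  f =1 g.
Proof.
move=> fgM fT gT fgS eta0; apply/eqP; rewrite -subr_eq0.
have [Phi Phi_ge Phi_topple] := lyapunov.
have [theta /andP[t0 t1] tP] := Phi_topple (count eta0).
have bound n eta : (count eta <= count eta0)%N ->
    `|f eta - g eta| <= M * theta ^+ n * Phi eta.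
  have M0 : 0 <= M by apply: le_trans (fgM eta0).
  elim: n eta => [|n IH] eta cN.
    have [/stableP[S ->]|/forallPn[x]] := boolP [forall x, ~~ active eta x].
      by rewrite fgS subrr normr0 !mulr_ge0// (Phi_ge _).1.
    rewrite negbK => ax; rewrite mulr1 (le_trans (fgM _))// ler_peMr//.
    exact: (Phi_ge _).2 ax.
  have [/stableP[S ->]|/forallPn[x]] := boolP [forall x, ~~ active eta x].
    by rewrite fgS subrr normr0 !mulr_ge0 ?exprn_ge0// (Phi_ge _).1.
  rewrite negbK => ax; rewrite -(fT _ _ ax) -(gT _ _ ax) -toppleB.
  rewrite (le_trans (topple_norm Ksub lambda_gt0 _ _ _))//.
  apply: (@le_trans _ _ (T x (fun xi => M * theta ^+ n * Phi xi) eta)).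
    by apply: ler_topple => // i; apply: IH; rewrite (leq_trans (count_act _ _)).
  rewrite toppleZ exprSr -!mulrA ler_wpM2l// ler_wpM2l ?exprn_ge0//.
  exact: tP.
rewrite -normr_eq0 eq_le normr_ge0 andbT.
have cvg0 : M * theta ^+ n * Phi eta0 @[n --> \oo] --> (0 : R).
  rewrite -(mul0r (Phi eta0)) -(mulr0 M).
  by apply: cvgMl; apply: cvgMr; apply: cvg_expr; rewrite ger0_norm.
by apply: ler_cvg_to (cvg_cst _) cvg0 _; near=> n; exact: bound.
Unshelve. all: by end_near. Qed.

End Abelian.

(** * Uniformization and stabilization *)

Section CauchyProduct.
Variable R : realType.
Implicit Types x y : R^nat.

Lemma sum_antidiagonals (F : nat -> nat -> R) n :
  \sum_(0 <= k < n) \sum_(0 <= i < k.+1) F i (k - i)%N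
  = \sum_(0 <= i < n) \sum_(0 <= j < n - i) F i j.
Proof.
elim: n => [|n IH]; first by rewrite !big_nil.
rewrite big_nat_recr//= IH [RHS]big_nat_recr//= subSnn.
rewrite [X in _ = _ + X]big_nat1 [X in _ + X = _]big_nat_recr//= subnn addrA.
congr (_ + _); rewrite -big_split/= !big_nat; apply: eq_bigr => i /= ilt.
by rewrite subSn 1?ltnW// [RHS]big_nat_recr.
Qed.

(** Mertens' theorem. What is left is the convolution of [x] with the error [d] of the partial sums
    of [y], cut at [n0]: below it [d (n - i)] is small, above it the tail of [|x|] is. *)
Lemma cauchy_product x y : cvgn (series (fun k => `|x k|)) -> cvgn (series y) ->
  series (fun k => \sum_(0 <= i < k.+1) x i * y (k - i)%N) n @[n --> \oo] -->
  limn (series x) * limn (series y).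
Proof.
set nx : R^nat := fun k => `|x k| => cx cy; set B := limn (series y).
have cx' : cvgn (series x) by exact: normed_cvg.
pose d m := series y m - B.
have d0 : d m @[m --> \oo] --> (0 : R).
  rewrite -(subrr B); apply: cvgB; [exact: cy|exact: cvg_cst].
have serE n : series (fun k => \sum_(0 <= i < k.+1) x i * y (k - i)%N) n
    = series x n * B + \sum_(0 <= i < n) x i * d (n - i)%N.
  rewrite /series /= (sum_antidiagonals (fun i j => x i * y j)) mulr_suml.
  rewrite -big_split/=; apply: eq_bigr => i _.
  by rewrite -mulr_sumr -mulrDr addrC subrK.
rewrite (eq_cvg _ _ serE) -(addr0 (_ * B)); apply: cvgD.
  by apply: cvgMl; exact: cx'.
have [M [_ dM]] := cvg_seq_bounded (cvgP _ d0).
pose M1 := `|M| + 1.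
have dM1 m : `|d m| <= M1.
  by apply: dM => //; rewrite /M1 (le_lt_trans (ler_norm M))// ltrDl.
have M1_gt0 : 0 < M1 by rewrite /M1 ltr_wpDl.
pose X := limn (series nx).
have nd : nondecreasing_seq (series nx).
  by apply: nondecreasing_series => *; exact: normr_ge0.
have Xub n : series nx n <= X by exact: nondecreasing_cvgn_le.
have X_ge0 : 0 <= X.
  by apply: le_trans (Xub 0%N); rewrite seriesEnat /= big_geq.
apply/cvgr0Pnorm_le => e e0.
have e1 : 0 < e / 2 / (X + 1) by rewrite !divr_gt0// ltr_wpDl.
have e2 : 0 < e / 2 / M1 by rewrite !divr_gt0.
have [m0 _ dm0] := (cvgr0Pnorm_le _).1 d0 _ e1.
have Xe : X - e / 2 / M1 < X by rewrite ltrBlDr ltrDl.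
have [n0 _ Xn0] := cvgr_ge _ cx _ Xe.
near=> n.
have n0n : (n0 <= n)%N by apply: leq_trans (leq_addr m0 n0) _; near: n; exact: nbhs_infty_ge.
rewrite (le_trans (ler_norm_sum _ _ _))// (big_cat_nat _ n0n)//= [e]splitr lerD//.
  have le1 : \sum_(0 <= i < n0) `|x i * d (n - i)%N|
      <= e / 2 / (X + 1) * \sum_(0 <= i < n0) `|x i|.
    rewrite mulr_sumr !big_nat; apply: ler_sum => i /= ilt.
    rewrite normrM mulrC ler_wpM2r//; apply: dm0 => /=.
    rewrite leq_subRL ?(leq_trans (ltnW ilt))//.
    rewrite (@leq_trans (n0 + m0)%N) ?leq_add2r ?(ltnW ilt)//.
    by near: n; exact: nbhs_infty_ge.
  rewrite (le_trans le1)// mulrAC ler_pdivrMr ?ltr_wpDl// ler_wpM2l ?divr_ge0 ?(ltW e0)//.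
  by rewrite (le_trans (Xub n0))// lerDl.
have le2 : \sum_(n0 <= i < n) `|x i * d (n - i)%N|
    <= M1 * \sum_(n0 <= i < n) `|x i|.
  rewrite mulr_sumr; apply: ler_sum => i _.
  by rewrite normrM mulrC ler_wpM2r.
rewrite (le_trans le2)// -ler_pdivlMl// mulrC.
have : series nx n - series nx n0 <= e / 2 / M1.
  by rewrite lerBlDr (le_trans (Xub n))// addrC -lerBlDr; exact: Xn0 (leqnn _).
by rewrite sub_series_geq.
Unshelve. all: by end_near. Qed.

End CauchyProduct.

(** Binomial expansion of [(U - 1)^k U^m], with [D k m] standing for its value; [U] will be the
    uniformized operator. *)
Lemma iterated_difference (R : realType) (D : nat -> nat -> R) :
    (forall k m, D k.+1 m = D k m.+1 - D k m) ->
  forall k m, D k m =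
    \sum_(0 <= i < k.+1) (-1) ^+ (k + i) * 'C(k, i)%:R * D 0%N (m + i)%N.
Proof.
move=> DS; elim=> [|k IH] m; first by rewrite big_nat1 addn0 !mul1r addn0.
have E : - \sum_(0 <= i < k.+1) (-1) ^+ (k + i) * 'C(k, i)%:R * D 0%N (m + i)%N
    = \sum_(0 <= i < k.+2)
        (-1) ^+ (k.+1 + i) * 'C(k, i)%:R * D 0%N (m + i)%N.
  rewrite [RHS]big_nat_recr//= bin_small// mulr0 mul0r addr0 -sumrN.
  by apply: eq_bigr => i _; rewrite addSn exprS mulN1r !mulNr.
rewrite DS !IH E [RHS]big_nat_recl// [X in _ + X = _]big_nat_recl//.
rewrite !bin0 addrCA; congr (_ + _); rewrite -big_split/=.
apply: eq_bigr => i _; rewrite binS natrD addSnnS addnS.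
have -> : (-1) ^+ (k.+1 + i.+1) = (-1) ^+ (k + i) :> R.
  by rewrite addSn addnS !exprS !mulN1r opprK.
by ring.
Qed.

(** * Exponential decay of the semigroup on functions vanishing at stable configurations *)

Section Stabilization.
Variables (R : realType) (V : finType) (K : V -> V -> R) (lambda : R).
Hypotheses (Ksub : substochastic K) (Knd : nondegenerate_kernel K).
Hypothesis lambda_gt0 : 0 < lambda.
Implicit Types (f g : conf V -> R) (eta xi : conf V) (S : {set V}).

Local Notation T := (topple K lambda).
Local Notation L := (generator K lambda).
Local Notation absorb := (absorb K lambda).

Lemma generator_lin c f g :
  L (fun xi => c * (f xi - g xi)) = fun xi => c * (L f xi - L g xi).
Proof.
apply/funext => xi; rewrite !generatorE// -sumrB mulr_sumr.
by apply: eq_bigr => x _; rewrite toppleZ toppleB; ring.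
Qed.

Lemma iter_generator_lin k c f g :
  iter k L (fun xi => c * (f xi - g xi))
  = fun xi => c * (iter k L f xi - iter k L g xi).
Proof. by elim: k => //= k ->; rewrite generator_lin. Qed.

Lemma generator_harmonic f :
  (forall eta x, active eta x -> T x f eta = f eta) -> L f = fun=> 0.
Proof.
move=> fT; apply/funext => xi; rewrite generatorE// big1// => x _.
have [ax|] := boolP (active xi x); first by rewrite fT// subrr mulr0.
by rewrite /active lt0n negbK => /eqP ->; rewrite !mul0r.
Qed.

Variables (eta0 : conf V) (w : conf V -> R).
Hypotheses (w1 : forall xi, `|w xi| <= 1) (w0 : forall S, w (stable_conf S) = 0).

Let N := count eta0.
(** At most [N] particles topple at total rate at most [(1 + lambda) * N]; the successor keeps [C]
    positive. *)
Let C := (1 + lambda) * N.+1%:R.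
Let C_gt0 : 0 < C. Proof. by rewrite mulr_gt0// addr_gt0. Qed.
(* One step of the uniformized chain: [L = C (unif - 1)]. *)
Let unif f : conf V -> R := fun xi => f xi + C^-1 * L f xi.
Let a m := iter m unif w.

(** A convex combination of [f xi] and topplings as long as there are at most [N] particles, a
    condition preserved by the dynamics. *)
Let unifE f xi : unif f xi = (1 - (\sum_x nactive (xi x))%:R / N.+1%:R) * f xi
  + N.+1%:R^-1 * \sum_x (nactive (xi x))%:R * T x f xi.
Proof.
rewrite /unif; have -> : L f xi = (1 + lambda) * (\sum_x (nactive (xi x))%:R * T x f xi
    - (\sum_x nactive (xi x))%:R * f xi).
  rewrite generatorE// natr_sum mulr_suml -sumrB mulr_sumr.
  by apply: eq_bigr => x _; ring.
have l1 : 1 + lambda != 0 by rewrite gt_eqF// addr_gt0.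
by rewrite /C; field; rewrite l1 nat1r pnatr_eq0.
Qed.

Let a_stable m S : a m (stable_conf S) = 0.
Proof.
elim: m => [|m IH]; first exact: w0.
rewrite (_ : a m.+1 = unif (a m))// unifE IH mulr0 add0r big1 ?mulr0// => x _.
have := stable_active S x; rewrite /active lt0n => /negbFE/eqP ->.
by rewrite mul0r.
Qed.

(** In an unstable configuration a uniformized step is a legal toppling with probability at least
    [1 / N.+1], so the contraction of the Lyapunov function survives with a weaker factor. *)
Lemma unif_decay : exists2 theta : R, 0 <= theta < 1 & exists M, forall m,
  `|a m eta0| <= M * theta ^+ m.
Proof.
have [Phi Phi_ge Phi_topple] := lyapunov Ksub Knd lambda_gt0.
have [th /andP[th0 th1] thP] := Phi_topple N.
pose theta := 1 - (1 - th) / N.+1%:R.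
have N0 : 0 < N.+1%:R :> R by rewrite ltr0n.
have theta0 : 0 <= theta.
  rewrite subr_ge0 ler_pdivrMr// mul1r (@le_trans _ _ 1) ?ler1n//.
  by rewrite lerBlDr lerDl.
exists theta; first by rewrite theta0 ltrBlDr ltrDl divr_gt0// subr_gt0.
exists (Phi eta0) => m; have : (count eta0 <= N)%N by [].
move: eta0; elim: m => [|m IH] xi cN.
  have [/stableP[S ->]|/forallPn[x]] := boolP [forall x, ~~ active xi x].
    by rewrite a_stable normr0 mulr1 (Phi_ge _).1.
  by rewrite negbK => ax; rewrite mulr1 (le_trans (w1 _))// ((Phi_ge _).2 x).
have [/stableP[S ->]|/forallPn[x0]] := boolP [forall x, ~~ active xi x].
  by rewrite a_stable normr0 mulr_ge0 ?exprn_ge0// (Phi_ge _).1.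
rewrite negbK => ax0; rewrite (_ : a m.+1 = unif (a m))// unifE; set n := (\sum_x _)%N.
have nN : (n <= N)%N.
  by apply: leq_trans cN; apply: leq_sum => x _; case: (xi x).
have n1 : 0 <= 1 - n%:R / N.+1%:R :> R.
  by rewrite subr_ge0 ler_pdivrMr// mul1r ler_nat leqW.
have n_gt0 : (0 < n)%N.
  by apply: leq_trans ax0 _; rewrite /n (bigD1 x0)//= leq_addr.
apply: (@le_trans _ _
    ((1 - n%:R / N.+1%:R * (1 - th)) * (Phi xi * theta ^+ m))); last first.
  rewrite exprS [leRHS]mulrCA ler_wpM2r ?mulr_ge0 ?exprn_ge0 ?(Phi_ge _).1//.
  rewrite lerD2l lerN2 mulrC -mulrA ler_peMl ?ler1n//.
  by rewrite mulr_ge0 ?invr_ge0// subr_ge0 ltW.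
rewrite (le_trans (ler_normD _ _))// !normrM (ger0_norm n1).
rewrite [`|N.+1%:R^-1|]ger0_norm ?invr_ge0//.
have -> : 1 - n%:R / N.+1%:R * (1 - th)
    = (1 - n%:R / N.+1%:R) + N.+1%:R^-1 * (n%:R * th) by ring.
rewrite [leRHS]mulrDl lerD//; first by rewrite ler_wpM2l//; exact: IH.
rewrite -!mulrA ler_wpM2l ?invr_ge0//.
rewrite (le_trans (ler_norm_sum _ _ _))// natr_sum mulr_suml.
apply: ler_sum => x _; rewrite normrM normr_nat.
have [ax|] := boolP (active xi x); last first.
  by rewrite /active lt0n negbK => /eqP ->; rewrite !mul0r.
rewrite ler_wpM2l// (le_trans (topple_norm Ksub lambda_gt0 _ _ _))//.
apply: (@le_trans _ _ (T x (fun zt => theta ^+ m * Phi zt) xi)).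
  apply: ler_topple => // i; rewrite mulrC; apply: IH.
  by rewrite (leq_trans (count_act _ _)).
by rewrite toppleZ mulrA [leRHS]mulrC ler_wpM2l ?exprn_ge0// thP.
Qed.

Let iter_generator_unif k m :
  C^-1 ^+ k.+1 * iter k.+1 L (a m) eta0 =
  C^-1 ^+ k * iter k L (a m.+1) eta0 - C^-1 ^+ k * iter k L (a m) eta0.
Proof.
have C0 : C != 0 by rewrite gt_eqF.
have -> : iter k.+1 L (a m) = iter k L (fun xi => C * (a m.+1 xi - a m xi)).
  rewrite iterSr; congr iter; apply/funext => xi.
  by rewrite (_ : a m.+1 = unif (a m))// /unif addrAC subrr add0r mulVKf.
by rewrite iter_generator_lin exprSr -[RHS]mulrBr -[LHS]mulrA mulKf.
Qed.

(** The identity [exp (tL) = exp (- C t) exp (C t unif)], read at order [k]. *)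
Let semigroup_term (t : R) k :
  t ^+ k / k`!%:R * iter k L w eta0 =
  \sum_(0 <= i < k.+1) (C * t) ^+ i / i`!%:R * a i eta0
                       * exp_coeff (- (C * t)) (k - i)%N.
Proof.
have C0 : C != 0 by rewrite gt_eqF.
have := @iterated_difference R _ iter_generator_unif k 0%N.
rewrite expr0 => DE.
have -> : iter k L w eta0 = C ^+ k * (C^-1 ^+ k * iter k L (a 0%N) eta0).
  by rewrite mulrA -exprMn divff// expr1n mul1r.
rewrite DE !mulr_sumr !big_nat; apply: eq_bigr => i /= ik.
rewrite add0n mul1r /exp_coeff/= -[- (C * t)]mulN1r [(-1 * _) ^+ _]exprMn.
have fact0 n : n`!%:R != 0 :> R by rewrite pnatr_eq0 -lt0n fact_gt0.
have bin0 : 'C(k, i)%:R != 0 :> R by rewrite pnatr_eq0 -lt0n bin_gt0.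
have -> : (-1) ^+ (k + i) = (-1) ^+ (k - i) :> R.
  by rewrite -signr_odd -[RHS]signr_odd oddB// oddD.
have -> : t ^+ k = (C^-1) ^+ k * ((C * t) ^+ i * (C * t) ^+ (k - i)).
  by rewrite -exprD subnKC// -exprMn mulKf.
rewrite -(@bin_fact k i)// !natrM exprVn; field.
by rewrite bin0 !fact0 expf_neq0.
Qed.

(** The series in powers of [unif] is at most [M * exp (theta C t)], which the factor [exp (- C t)]
    beats: hence the rate [(1 - theta) * C]. *)
Lemma semigroup_decay : exists M mu : R, 0 < mu /\ forall t, 0 <= t ->
  cvgn (series (fun k => t ^+ k / k`!%:R * iter k L w eta0)) /\
  `|semigroup K lambda t w eta0| <= M * expR (- (mu * t)).
Proof.
have [theta /andP[th0 th1] [M aM]] := unif_decay.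
exists M, ((1 - theta) * C); split; first by rewrite mulr_gt0// subr_gt0.
move=> t t0; set s := C * t; have s0 : 0 <= s by rewrite mulr_ge0// ltW.
pose x i := s ^+ i / i`!%:R * a i eta0.
have xM i : `|x i| <= M * exp_coeff (theta * s) i.
  rewrite /x normrM ger0_norm ?divr_ge0 ?exprn_ge0//.
  have -> : M * exp_coeff (theta * s) i = s ^+ i / i`!%:R * (M * theta ^+ i).
    by rewrite /exp_coeff/= exprMn; ring.
  by rewrite ler_wpM2l ?divr_ge0 ?exprn_ge0.
have lM : series (fun i => M * exp_coeff (theta * s) i) n @[n --> \oo] -->
    M * expR (theta * s).
  rewrite (_ : series _ = fun n => M * series (exp_coeff (theta * s)) n).
    by apply: cvgMr; exact: is_cvg_series_exp_coeff.
  by apply/funext => n; rewrite /series/= mulr_sumr.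
have cM := cvgP _ lM.
have cx : cvgn (series (fun i => `|x i|)).
  by apply: series_le_cvg cM => // i; apply: le_trans (xM i).
have cy := @is_cvg_series_exp_coeff R (- s).
have cZ := cauchy_product cx cy.
have E : (fun k => t ^+ k / k`!%:R * iter k L w eta0) =
    (fun k => \sum_(0 <= i < k.+1) x i * exp_coeff (- s) (k - i)%N).
  by apply/funext => k; exact: semigroup_term.
rewrite /semigroup E; split; first by apply/cvg_ex; eexists; exact: cZ.
rewrite (cvg_lim _ cZ)// normrM [X in _ * X <= _]ger0_norm; last exact: expR_ge0.
have -> : - ((1 - theta) * C * t) = theta * s - s by rewrite /s; ring.
rewrite expRD mulrA ler_wpM2r ?expR_ge0//.
rewrite (le_trans (lim_series_norm cx))// (le_trans (lim_series_le cx cM _))//.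
by rewrite (cvg_lim _ lM).
Qed.

End Stabilization.

(** The indicator of [stable_conf S] is [absorb] minus a function [w] vanishing at stable
    configurations. The generator kills [absorb], so the semigroup fixes it, and the part from [w]
    decays. *)
Lemma stabilizationE (R : realType) (V : finType) (K : V -> V -> R) (lambda : R) :
    substochastic K -> nondegenerate_kernel K -> 0 < lambda ->
  forall eta S, stabilization K lambda eta S = absorb K lambda eta S.
Proof.
move=> Ksub Knd lambda_gt0 eta S.
pose f xi : R := (xi == stable_conf S)%:R.
pose w xi : R := absorb K lambda xi S - f xi.
have w1 xi : `|w xi| <= 1.
  have /andP[] := absorb_bounds Ksub lambda_gt0 S xi.
  by rewrite /w /f ler_norml; case: eqP => _ /= *; apply/andP; split; lra.
have w0 S' : w (stable_conf S') = 0.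
  rewrite /w absorb_stable// /f (inj_eq (@stable_conf_inj V)); exact: subrr.
have fw : f = fun xi => 1 * (absorb K lambda xi S - w xi).
  by apply/funext => xi; rewrite mul1r /w opprB addrC subrK.
clearbody w.
have [M [mu [mu0 wM]]] := semigroup_decay Ksub Knd lambda_gt0 eta w1 w0.
have iterA k : iter k.+1 (generator K lambda) (absorb K lambda ^~ S) = fun=> 0.
  elim: k => [|k IH].
    by apply: generator_harmonic => // *; exact: absorb_topple.
  by rewrite iterS IH; apply: generator_harmonic => // *; exact: topple_cst.
pose u t k : R := t ^+ k / k`!%:R * iter k (generator K lambda) w eta.
have series_f t n : series (fun k => t ^+ k / k`!%:R *
      iter k (generator K lambda) f eta) n.+1
    = absorb K lambda eta S - series (u t) n.+1.
  rewrite fw /series /= !big_nat_recl//= /u expr0 divr1 !mul1r opprD addrA.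
  congr (_ + _); rewrite -sumrN; apply: eq_bigr => k _.
  by rewrite -!iterS iter_generator_lin// mul1r iterA sub0r mulrN.
have semi t : 0 <= t -> semigroup K lambda t f eta
    = absorb K lambda eta S - semigroup K lambda t w eta.
  move=> t0; have [cu _] := wM t t0; rewrite /semigroup.
  apply: cvg_lim => //; rewrite -(cvg_shiftS (series _)).
  rewrite (_ : [sequence _]_n = fun n => absorb K lambda eta S - series (u t) n.+1);
    last by apply/funext => n; exact: series_f.
  apply: cvgB; first exact: cvg_cst.
  by rewrite (cvg_shiftS (series _)); exact: cu.
apply: cvg_lim => //.
have expM0 : M * expR (- (mu * t)) @[t --> +oo] --> (0 : R).
  rewrite -(mulr0 M); apply: cvgMr.
  apply: (cvg_comp (fun t => mu * t) (fun t => expR (- t))) (@cvgr_expR R).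
  exact: gt0_cvgMry.
have semi0 : semigroup K lambda t w eta @[t --> +oo] --> (0 : R).
  apply/norm_cvg0P; apply: (squeeze_cvgr _ (cvg_cst 0) expM0).
  near=> t; have t0 : 0 <= t by near: t; apply: nbhs_pinfty_ge; exact: num_real.
  by rewrite normr_ge0 (wM t t0).2.
have lim0 : absorb K lambda eta S - semigroup K lambda t w eta @[t --> +oo] -->
    absorb K lambda eta S.
  by have := cvgB (cvg_cst (absorb K lambda eta S)) semi0; rewrite subr0; apply.
apply: cvg_trans lim0; apply: near_eq_cvg; near=> t.
by apply/esym/semi; near: t; apply: nbhs_pinfty_ge; exact: num_real.
Unshelve. all: by end_near. Qed.

(** * Internal DLA *)

Section ExitKernel.
Variables (R : realType) (V : finType) (K : V -> V -> R) (nu : V -> R).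
Hypotheses (Ksub : substochastic K) (Knd : nondegenerate_kernel K).
Hypotheses (nuP : prob_distribution nu) (Kadm : admissible K nu).
Implicit Types (A B : {set V}) (u v : {set V} -> R) (x y : V).

Let K_ge0 x y : 0 <= K x y. Proof. by have /andP[] := Ksub.1 x y. Qed.

Definition kill x : R := 1 - \sum_y K x y.

Lemma kill_ge0 x : 0 <= kill x. Proof. by rewrite subr_ge0 Ksub.2. Qed.

Definition restr A x y : R := if x \in A then K x y else 0.

Lemma restr_sub A : substochastic (restr A).
Proof.
split=> [x y|x]; rewrite /restr; case: (x \in A).
- exact: Ksub.1.
- by rewrite lexx ler01.
- exact: Ksub.2.
- by rewrite big1// ler01.
Qed.

Lemma restr_nd A : nondegenerate_kernel (restr A).
Proof.
move=> B B0 B1; apply: (Knd B0) => x xB; rewrite -(B1 x xB).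
apply: eq_bigr => y _; rewrite /restr; case: ifPn => // xA.
have := B1 x xB; rewrite big1 => [/eqP|z _]; first by rewrite eq_sym oner_eq0.
by rewrite /restr (negPf xA).
Qed.

(* [exit_prob A x B]: probability that the cluster [A] becomes [B] when a particle
   walks from [x] until it leaves [A] or is killed. *)
Definition exit_prob A x B : R :=
  sval (kernel_solve (restr_sub A) (@restr_nd A)
    (fun x => if x \in A then kill x * (A == B)%:R else (x |: A == B)%:R)) x.

Definition exit A u x : R := \sum_B exit_prob A x B * u B.

Lemma exit_probE A x B : exit_prob A x B =
  (if x \in A then kill x * (A == B)%:R else (x |: A == B)%:R)
  + \sum_y restr A x y * exit_prob A y B.
Proof. exact: (svalP (kernel_solve _ _ _)). Qed.

Lemma sum_delta A u : \sum_B (A == B)%:R * u B = u A.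
Proof.
rewrite (bigD1 A)//= eqxx mul1r big1 ?addr0// => B /negPf BA.
by rewrite eq_sym BA mul0r.
Qed.

Lemma exitE A u x :
  exit A u x = (if x \in A then kill x * u A else u (x |: A))
               + \sum_y restr A x y * exit A u y.
Proof.
rewrite /exit; under eq_bigr do rewrite exit_probE mulrDl.
rewrite big_split/=; congr (_ + _).
  case: ifP => _; last exact: sum_delta.
  by under eq_bigr do rewrite -mulrA; rewrite -mulr_sumr sum_delta.
under eq_bigr do rewrite mulr_suml.
rewrite exchange_big/=; apply: eq_bigr => y _; rewrite mulr_sumr.
by apply: eq_bigr => B _; rewrite mulrA.
Qed.

Lemma exit_out A u x : x \notin A -> exit A u x = u (x |: A).
Proof.
move=> xA; rewrite exitE (negPf xA) big1 ?addr0// => y _.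
by rewrite /restr (negPf xA) mul0r.
Qed.

Lemma exit_in A u x : x \in A ->
  exit A u x = kill x * u A + \sum_y K x y * exit A u y.
Proof.
by move=> xA; rewrite exitE xA; congr (_ + _); apply: eq_bigr => y; rewrite /restr xA.
Qed.

(** Here [f] is a supersolution of the exit equation; with [exit_ge] this replaces coupling
    arguments by one-step checks. *)
Lemma exit_le A u (f : V -> R) :
    (forall x, x \notin A -> u (x |: A) <= f x) ->
    (forall x, x \in A -> kill x * u A + \sum_y K x y * f y <= f x) ->
  forall x, exit A u x <= f x.
Proof.
move=> fo fi; apply: (max_principle (restr_sub A) (@restr_nd A)) => x.
under eq_bigr do rewrite mulrBr.
rewrite sumrB exitE.
suff : (if x \in A then kill x * u A else u (x |: A))
    + \sum_y restr A x y * f y <= f x by lra.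
case: ifPn => xA.
  rewrite (le_trans _ (fi x xA))// lerD2l.
  by under eq_bigr do rewrite /restr xA.
rewrite big1 ?addr0; first by rewrite fo.
by move=> y _; rewrite /restr (negPf xA) mul0r.
Qed.

Lemma exit_ge A u (f : V -> R) :
    (forall x, x \notin A -> f x <= u (x |: A)) ->
    (forall x, x \in A -> f x <= kill x * u A + \sum_y K x y * f y) ->
  forall x, f x <= exit A u x.
Proof.
move=> fo fi x; rewrite -lerN2.
have -> : - exit A u x = exit A (fun B => - u B) x.
  by rewrite /exit -sumrN; apply: eq_bigr => B _; rewrite mulrN.
apply: (@exit_le A _ (fun y => - f y)) => {x} x xA; first by rewrite lerN2 fo.
rewrite mulrN; under eq_bigr do rewrite mulrN.
by rewrite sumrN -opprD lerN2 fi.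
Qed.

Lemma exit_eq A u (f : V -> R) :
    (forall x, x \notin A -> f x = u (x |: A)) ->
    (forall x, x \in A -> f x = kill x * u A + \sum_y K x y * f y) ->
  forall x, f x = exit A u x.
Proof.
move=> fo fi x; apply/le_anti/andP; split.
  by move: x; apply: exit_ge => x xA; [rewrite fo|rewrite -fi].
by move: x; apply: exit_le => x xA; [rewrite fo|rewrite -fi].
Qed.

Lemma exit_cst A c x : exit A (fun=> c) x = c.
Proof.
symmetry; move: x; apply: exit_eq => // x xA.
by rewrite -mulr_suml -mulrDl subrK mul1r.
Qed.

Lemma exit_prob_exit A x B : exit_prob A x B = exit A (fun C => (C == B)%:R) x.
Proof.
rewrite /exit; under eq_bigr do rewrite mulrC eq_sym.
by rewrite sum_delta.
Qed.

Lemma exit_prob_ge0 A x B : 0 <= exit_prob A x B.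
Proof.
rewrite exit_prob_exit; move: x; apply: exit_ge => // x xA.
rewrite big1 => [|y _]; last by rewrite mulr0.
by rewrite addr0 mulr_ge0 ?kill_ge0.
Qed.

Lemma exit_prob_sub A x B : ~~ (A \subset B) -> exit_prob A x B = 0.
Proof.
move=> AB; rewrite exit_prob_exit; symmetry; move: x.
have nAB (C : {set V}) : A \subset C -> (C == B) = false.
  by move=> AC; apply: contraNF AB => /eqP <-.
apply: exit_eq => x xA; first by rewrite nAB// finset.subsetUr.
by rewrite nAB// mulr0 add0r big1// => y _; rewrite mulr0.
Qed.

Lemma le_exit A u v x : u A <= v A ->
  (forall x, x \notin A -> u (x |: A) <= v (x |: A)) -> exit A u x <= exit A v x.
Proof.
move=> uvA uv; move: x; apply: exit_le => x xA; first by rewrite exit_out// uv.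
by rewrite exit_in// lerD2r ler_wpM2l ?kill_ge0.
Qed.

(* One step of internal DLA: a particle starts from [nu] and enlarges the cluster
   [A] by the first site outside [A] that it visits, if any. *)
Definition idla A B : R := \sum_x nu x * exit_prob A x B.

Definition idla_op u A : R := \sum_B idla A B * u B.

Lemma idla_opE u A : idla_op u A = \sum_x nu x * exit A u x.
Proof.
rewrite /idla_op /exit; under eq_bigr do rewrite mulr_suml.
rewrite exchange_big/=; apply: eq_bigr => x _; rewrite mulr_sumr.
by apply: eq_bigr => B _; rewrite mulrA.
Qed.

Lemma idla_ge0 A B : 0 <= idla A B.
Proof.
apply: sumr_ge0 => x _; rewrite mulr_ge0 ?exit_prob_ge0//; exact: nuP.1.
Qed.

Lemma idla_op_cst c A : idla_op (fun=> c) A = c.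
Proof.
rewrite idla_opE; under eq_bigr do rewrite exit_cst.
by rewrite -mulr_suml nuP.2 mul1r.
Qed.

Lemma idla_sum A : \sum_B idla A B = 1.
Proof. by rewrite -[RHS](idla_op_cst 1 A); apply: eq_bigr => B _; rewrite mulr1. Qed.

Lemma idla_sub A B : ~~ (A \subset B) -> idla A B = 0.
Proof. by move=> AB; rewrite /idla big1// => x _; rewrite exit_prob_sub// mulr0. Qed.

Lemma le_idla_op u v A : u A <= v A ->
  (forall x, x \notin A -> u (x |: A) <= v (x |: A)) -> idla_op u A <= idla_op v A.
Proof.
move=> uvA uv; rewrite !idla_opE; apply: ler_sum => x _.
by rewrite ler_wpM2l ?le_exit//; exact: nuP.1.
Qed.

Lemma idla_opDZ c u v A :
  idla_op (fun B => c * u B + v B) A = c * idla_op u A + idla_op v A.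
Proof.
rewrite /idla_op mulr_sumr -big_split; apply: eq_bigr => B _ /=.
by rewrite mulrDr mulrCA.
Qed.

Lemma idla_setT : idla finset.setT finset.setT = 1.
Proof.
rewrite -(idla_sum finset.setT) (bigD1 finset.setT)//= big1 ?addr0// => B BT.
by rewrite idla_sub// finset.subTset.
Qed.

Lemma idla_op_setT u : idla_op u finset.setT = u finset.setT.
Proof.
rewrite /idla_op (bigD1 finset.setT)//= idla_setT mul1r big1 ?addr0// => B BT.
by rewrite idla_sub ?mul0r// finset.subTset.
Qed.

Lemma exit_prob_le1 A x B : exit_prob A x B <= 1.
Proof.
by rewrite exit_prob_exit -[leRHS](exit_cst A 1 x); apply: le_exit => *; case: eqP.
Qed.

(** If the cluster surely did not grow, walks from the support of [nu] would surely never leave [A].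
    This propagates along positive rates and, by admissibility, reaches a site outside [A]. *)
Lemma idla_lt1 A : A != finset.setT -> idla A A < 1.
Proof.
rewrite -finset.subTset => /subsetPn[z _ zA]; rewrite lt_neqAle; apply/andP; split.
  apply/eqP => qA.
  have sum0 : \sum_x nu x * (1 - exit_prob A x A) = 0.
    under eq_bigr do rewrite mulrBr mulr1.
    by rewrite sumrB nuP.2 -[X in _ - X]/(idla A A) qA subrr.
  have nuq x : 0 < nu x -> exit_prob A x A = 1.
    move=> nux; have /eqP := sum0; rewrite psumr_eq0; last first.
      by move=> y _; rewrite mulr_ge0 ?subr_ge0 ?exit_prob_le1//; exact: nuP.1.
    move/allP => /(_ x (mem_index_enum _)).
    by rewrite mulf_eq0 gt_eqF//= subr_eq0 => /eqP.
  have out y : y \notin A -> exit_prob A y A = 0.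
    move=> yA; rewrite exit_prob_exit exit_out//; case: eqP => // yAA.
    by rewrite -yAA setU11 in yA.
  have step x y : 0 < K x y -> exit_prob A x A = 1 -> exit_prob A y A = 1.
    move=> Kxy qx1; have [xA|xA] := boolP (x \in A); last first.
      by move: qx1; rewrite out// => /eqP; rewrite eq_sym oner_eq0.
    have : \sum_y K x y * (1 - exit_prob A y A) = 0.
      under eq_bigr do rewrite mulrBr mulr1.
      suff E : exit_prob A x A = kill x + \sum_y K x y * exit_prob A y A.
        by rewrite sumrB; move: qx1; rewrite E /kill; lra.
      rewrite exit_probE xA eqxx mulr1; congr (_ + _).
      by apply: eq_bigr => t _; rewrite /restr xA.
    move/eqP; rewrite psumr_eq0 => [|t _]; last first.
      by rewrite mulr_ge0 ?subr_ge0 ?exit_prob_le1.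
    move/allP => /(_ y (mem_index_enum _)).
    by rewrite mulf_eq0 gt_eqF//= subr_eq0 => /eqP.
  have [x nux /connectP[p pK zE]] := Kadm z.
  have /eqP : exit_prob A z A = 1.
    rewrite zE; elim: p x {nux zE} (nuq x nux) pK => //= y p IH x qx /andP[Kxy pK].
    exact: IH (step _ _ Kxy qx) pK.
  by rewrite out// eq_sym oner_eq0.
rewrite -(idla_sum A) (bigD1 A)//= lerDl sumr_ge0// => B _; exact: idla_ge0.
Qed.

(** Killing the absorbing state [V] makes the kernel non-degenerate, so that filling-time equations
    have unique solutions. *)
Definition idla_killed A B : R := if A == finset.setT then 0 else idla A B.

Lemma idla_killed_sub : substochastic idla_killed.
Proof.
split=> [A B|A]; rewrite /idla_killed; case: (A == finset.setT).
- by rewrite lexx ler01.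
- rewrite idla_ge0 -(idla_sum A) (bigD1 B)//= lerDl sumr_ge0// => C _.
  exact: idla_ge0.
- by rewrite big1// ler01.
- by rewrite idla_sum.
Qed.

(** In a stochastic family of clusters, a cluster of maximal size could only stay put, because
    clusters never shrink. *)
Lemma idla_killed_nd : nondegenerate_kernel idla_killed.
Proof.
move=> Z /set0Pn[A0 A0Z] Z1.
have [A AZ Amax] := arg_maxnP (fun A : {set V} => #|A|) A0Z.
have := Z1 A AZ; rewrite /idla_killed; have [_|AT] := eqVneq A finset.setT.
  by rewrite big1// => /eqP; rewrite eq_sym oner_eq0.
apply/eqP; rewrite lt_eqF// (le_lt_trans _ (idla_lt1 AT))//.
rewrite (bigD1 A)//= big1 ?addr0// => B /andP[BZ BA]; apply: idla_sub.
apply: contra BA => AB; rewrite eq_sym eqEcard AB; exact: Amax.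
Qed.

End ExitKernel.

(** * The filling time *)

Section FillTime.
Variables (R : realType) (V : finType) (K : V -> V -> R) (nu : V -> R).
Hypotheses (Ksub : substochastic K) (Knd : nondegenerate_kernel K).
Hypotheses (nuP : prob_distribution nu) (Kadm : admissible K nu).
Implicit Types (A B : {set V}) (u v : {set V} -> R) (x y z : V).

Local Notation exit := (exit Ksub Knd).
Local Notation idla := (idla nu Ksub Knd).
Local Notation Q := (idla_op nu Ksub Knd).
Local Notation top := (finset.setT : {set V}).
Local Notation Qk := (idla_killed nu Ksub Knd).
Let Qk_sub := @idla_killed_sub _ _ _ _ Ksub Knd nuP.
Let Qk_nd := @idla_killed_nd _ _ _ _ Ksub Knd nuP Kadm.

(** Comparison form of running one walk against both clusters: they differ by [z] until the walk
    first hits [z], where one becomes [z |: A] and the other gains at most one more site. The case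
    [tau = 0] is monotonicity. *)
Lemma exit_lipschitz u tau : 0 <= tau -> (forall A x, u A <= u (x |: A) + tau) ->
  forall A z x, exit A u x <= exit (z |: A) u x + tau.
Proof.
move=> tau0 utau A z; have [zA x|zA] := boolP (z \in A).
  have -> : z |: A = A by apply/finset.setUidPr; rewrite finset.sub1set.
  by rewrite lerDl.
apply: exit_le => x xA; last first.
  rewrite [exit (z |: A) u x]exit_in; last by rewrite finset.in_setU xA orbT.
  under eq_bigr do rewrite mulrDr.
  rewrite big_split/= -mulr_suml.
  have : kill K x * u A <= kill K x * (u (z |: A) + tau).
    by rewrite ler_wpM2l ?kill_ge0.
  by rewrite /kill; set S1 := \sum_y K x y; lra.
have [->|xz] := eqVneq x z; last first.
  by rewrite exit_out ?inE ?negb_or ?xz// finset.setUCA.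
rewrite -lerBlDr.
apply: (@exit_ge _ _ _ Ksub Knd _ _ (fun=> u (z |: A) - tau)) => {xA}x _.
  by rewrite lerBlDr.
have : 0 <= kill K x * tau by rewrite mulr_ge0 ?kill_ge0.
by rewrite -mulr_suml /kill; set S1 := \sum_y K x y; lra.
Qed.

Lemma idla_lipschitz u tau : 0 <= tau -> (forall A x, u A <= u (x |: A) + tau) ->
  forall A z, Q u A <= Q u (z |: A) + tau.
Proof.
move=> tau0 utau A z; rewrite !idla_opE -[tau]mul1r -nuP.2 mulr_suml -big_split/=.
apply: ler_sum => x _; rewrite -mulrDr ler_wpM2l//; first exact: nuP.1.
exact: exit_lipschitz.
Qed.

Lemma idla_monotone u : (forall A x, u A <= u (x |: A)) ->
  forall A z, Q u A <= Q u (z |: A).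
Proof.
move=> um A z; rewrite -[leRHS]addr0; apply: idla_lipschitz => // B x.
by rewrite addr0.
Qed.

Lemma le_subset u : (forall A x, u A <= u (x |: A)) ->
  forall A B, A \subset B -> u A <= u B.
Proof.
move=> um A B; have [n] := ubnP #|B :\: A|; elim: n A => // n IH A cn AB.
have [BA|/subsetPn[x xB xA]] := boolP (B \subset A).
  by rewrite (_ : A = B)//; apply/eqP; rewrite finset.eqEsubset AB.
apply: le_trans (um A x) (IH _ _ _); last first.
  by rewrite finset.subUset finset.sub1set xB.
rewrite -ltnS (leq_trans _ cn)// ltnS; apply: proper_card.
apply/properP; split; first by apply: finset.setDS; exact: finset.subsetUr.
by exists x; rewrite !inE xB ?xA// eqxx.
Qed.

(* Probability that the IDLA cluster started from [A] fills [V] within [t] steps. *)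
Definition filled t A : R := iter t Q (fun B => (B == top)%:R) A.

Lemma filled0 A : filled 0 A = (A == top)%:R. Proof. by []. Qed.

Lemma filledS t A : filled t.+1 A = Q (filled t) A. Proof. by []. Qed.

Lemma filled_top t : filled t top = 1.
Proof.
elim: t => [|t IH]; first by rewrite filled0 eqxx.
by rewrite filledS idla_op_setT.
Qed.

Lemma filled_ge0 t A : 0 <= filled t A.
Proof.
elim: t A => [|t IH] A; first by rewrite filled0; case: eqP.
by rewrite filledS -[leLHS](idla_op_cst Ksub Knd nuP 0 A) le_idla_op.
Qed.

Lemma filled_le1 t A : filled t A <= 1.
Proof.
elim: t A => [|t IH] A; first by rewrite filled0; case: eqP => //; rewrite ler01.
by rewrite filledS -[leRHS](idla_op_cst Ksub Knd nuP 1 A) le_idla_op.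
Qed.

Lemma filled_leS t A : filled t A <= filled t.+1 A.
Proof.
elim: t A => [|t IH] A; last by rewrite !filledS le_idla_op.
have [->|AT] := eqVneq A top; first by rewrite !filled_top.
by rewrite [leLHS]filled0 (negPf AT) filled_ge0.
Qed.

Definition surv t A : R := 1 - filled t A.

Lemma survS t A : surv t.+1 A = Q (surv t) A.
Proof.
rewrite /surv filledS.
have := idla_opDZ nu Ksub Knd (-1) (filled t) (fun=> 1) A.
rewrite idla_op_cst// mulN1r addrC => <-.
by apply: eq_bigr => B _; rewrite mulN1r addrC.
Qed.

Lemma surv_top t : surv t top = 0. Proof. by rewrite /surv filled_top subrr. Qed.

Lemma surv_ge0 t A : 0 <= surv t A.
Proof. by rewrite subr_ge0 filled_le1. Qed.

Lemma surv0 A : surv 0 A = (A != top)%:R.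
Proof. by rewrite /surv filled0; case: eqP => _; rewrite ?subrr ?subr0. Qed.

Lemma killed_opE u A : A != top -> \sum_B Qk A B * u B = Q u A.
Proof. by move=> AT; apply: eq_bigr => B _; rewrite /idla_killed (negPf AT). Qed.

Lemma killed_op_top u : \sum_B Qk top B * u B = 0.
Proof. by rewrite big1// => B _; rewrite /idla_killed eqxx mul0r. Qed.

(* Expectation and variance of the filling time started from [A]. *)
Definition mean : {set V} -> R :=
  sval (kernel_solve Qk_sub Qk_nd (fun A => (A != top)%:R)).

(** The source term is the mean square of the one-step martingale increment [1 + mean B - mean A],
    up to sign. *)
Definition var : {set V} -> R :=
  sval (kernel_solve Qk_sub Qk_nd (fun A => if A == top then 0 else
    Q (fun B => (mean A - 1 - mean B) ^+ 2) A)).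

Lemma meanE A : mean A = (A != top)%:R + \sum_B Qk A B * mean B.
Proof. exact: (svalP (kernel_solve _ _ _)). Qed.

Lemma mean_top : mean top = 0.
Proof. by rewrite meanE killed_op_top eqxx addr0. Qed.

Lemma mean_step A : A != top -> mean A = 1 + Q mean A.
Proof. by move=> AT; rewrite meanE killed_opE// AT. Qed.

Lemma varE A : var A = (if A == top then 0 else
    Q (fun B => (mean A - 1 - mean B) ^+ 2) A) + \sum_B Qk A B * var B.
Proof. exact: (svalP (kernel_solve _ _ _)). Qed.

Lemma idla_op_ge0 u A : (forall B, 0 <= u B) -> 0 <= Q u A.
Proof. by move=> u0; rewrite -[leLHS](idla_op_cst Ksub Knd nuP 0 A) le_idla_op. Qed.

Lemma mean_ge0 A : 0 <= mean A.
Proof.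
move: A; apply: (min_principle Qk_sub Qk_nd) => A.
by rewrite [leRHS]meanE lerDr.
Qed.

Lemma mean_ge1 A : A != top -> 1 <= mean A.
Proof. by move=> AT; rewrite mean_step// lerDl idla_op_ge0// => B; exact: mean_ge0. Qed.

Lemma var_ge0 A : 0 <= var A.
Proof.
move: A; apply: (min_principle Qk_sub Qk_nd) => A.
rewrite [leRHS]varE lerDr; case: ifP => // _.
by apply: idla_op_ge0 => B; exact: sqr_ge0.
Qed.

Lemma var_top : var top = 0.
Proof. by rewrite varE killed_op_top eqxx addr0. Qed.

Lemma idla_op_scale c u A : Q (fun B => c * u B) A = c * Q u A.
Proof.
rewrite -[RHS]addr0 -(idla_op_cst Ksub Knd nuP 0 A) -idla_opDZ; apply: eq_bigr => B _.
by rewrite addr0.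
Qed.

(* [E_A (T - a)^2 = var A + (mean A - a)^2] obeys the Markov property at time 1. *)
Definition dev a A : R := var A + (mean A - a) ^+ 2.

Lemma dev_ge0 a A : 0 <= dev a A.
Proof. by rewrite addr_ge0 ?var_ge0 ?sqr_ge0. Qed.

Lemma dev_step a A : A != top -> dev a A = Q (dev (a - 1)) A.
Proof.
move=> AT; have mA := mean_step AT.
rewrite /dev varE (negPf AT) killed_opE//.
(* Recentring the square at [mean A - 1] leaves a remainder linear in [mean B], whose average is
   given by [mean_step]. *)
have -> : Q (fun B => var B + (mean B - (a - 1)) ^+ 2) A =
  Q (fun B => 1 * (var B + (mean A - 1 - mean B) ^+ 2) +
      (2 * (mean A - a) * mean B
       + ((a - 1) ^+ 2 - (mean A - 1) ^+ 2))) A.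
  by apply: eq_bigr => B _; congr (_ * _); ring.
rewrite 2!idla_opDZ idla_op_cst// mul1r.
have -> : Q (fun B => var B + (mean A - 1 - mean B) ^+ 2) A =
    Q (fun B => 1 * var B + (mean A - 1 - mean B) ^+ 2) A.
  by apply: eq_bigr => B _; rewrite mul1r.
by rewrite idla_opDZ; move: mA; set q := Q mean A => ->; ring.
Qed.

(** [T > t] means [T >= t + 1], hence the deviation [t + 1 - a]. The Markov property shifts both [t]
    and [a] by one. *)
Lemma chebyshev_surv t a A : a <= t.+1%:R ->
  surv t A * (t.+1%:R - a) ^+ 2 <= dev a A.
Proof.
elim: t a A => [|t IH] a A at1.
  rewrite surv0; have [_|AT] := eqVneq A top; first by rewrite mul0r dev_ge0.
  rewrite mul1r /dev; have := mean_ge1 AT; have := var_ge0 A.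
  by move: (var A) (mean A) at1 => v m; nra.
have [->|AT] := eqVneq A top; first by rewrite surv_top mul0r dev_ge0.
rewrite survS dev_step// mulrC -idla_op_scale.
have le B : (t.+2%:R - a) ^+ 2 * surv t B <= dev (a - 1) B.
  have -> : t.+2%:R - a = t.+1%:R - (a - 1) by rewrite -(natr1 t.+1); ring.
  by rewrite mulrC; apply: IH; rewrite lerBlDr natr1.
by apply: le_idla_op => // *; exact: le.
Qed.

Lemma chebyshev_filled t a A : t%:R <= a ->
  filled t A * (a - t%:R) ^+ 2 <= dev a A.
Proof.
elim: t a A => [|t IH] a A ta.
  rewrite filled0; case: eqP => [->|_]; last by rewrite mul0r dev_ge0.
  by rewrite mul1r /dev var_top mean_top add0r sub0r sqrrN subr0.
have [->|AT] := eqVneq A top.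
  by rewrite filled_top /dev var_top mean_top; move: ta; rewrite -natr1; have := ler0n R t; nra.
rewrite filledS dev_step// mulrC -idla_op_scale.
have le B : (a - t.+1%:R) ^+ 2 * filled t B <= dev (a - 1) B.
  have -> : a - t.+1%:R = (a - 1) - t%:R by rewrite -natr1; ring.
  by rewrite mulrC; apply: IH; rewrite lerBrDr natr1.
by apply: le_idla_op => // *; exact: le.
Qed.

(** The mean is its own Lyapunov function: it drops by 1 per step and is bounded, as there are
    finitely many clusters. *)
Lemma mean_decay : exists2 theta : R, 0 <= theta < 1 &
  forall A, \sum_B Qk A B * mean B <= theta * mean A.
Proof.
pose M := 1 + \sum_A mean A.
have M1 : 1 <= M by rewrite lerDl sumr_ge0// => A _; exact: mean_ge0.
have M0 : 0 < M by apply: lt_le_trans M1.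
have mM A : mean A <= M.
  rewrite /M (bigD1 A)//= addrCA lerDl addr_ge0// sumr_ge0// => B _.
  exact: mean_ge0.
exists (1 - M^-1); first by rewrite subr_ge0 invf_le1// M1 ltrBlDr ltrDl invr_gt0.
move=> A; have [->|AT] := eqVneq A top.
  by rewrite killed_op_top mean_top mulr0.
have -> : \sum_B Qk A B * mean B = mean A - 1.
  by rewrite killed_opE// mean_step// addrC addKr.
by rewrite mulrBl mul1r lerD2l lerN2 ler_pdivrMl// mulr1.
Qed.

Lemma surv_decay : exists2 theta : R, 0 <= theta < 1 &
  forall t A, surv t A <= theta ^+ t * mean A.
Proof.
have [theta /andP[th0 th1] thm] := mean_decay.
exists theta; first by rewrite th0.
elim=> [|t IH] A.
  rewrite surv0 mul1r; have [->|AT] := eqVneq A top; first by rewrite mean_top.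
  exact: mean_ge1.
have [->|AT] := eqVneq A top; first by rewrite surv_top mean_top mulr0.
rewrite survS exprSr -mulrA; apply: le_trans (_ : theta ^+ t * Q mean A <= _).
  by rewrite -idla_op_scale; apply: le_idla_op.
by rewrite ler_wpM2l ?exprn_ge0// -killed_opE.
Qed.

Lemma surv_cvg0 A : surv t A @[t --> \oo] --> (0 : R).
Proof.
have [theta /andP[th0 th1] sth] := surv_decay.
have c0 : theta ^+ t * mean A @[t --> \oo] --> (0 : R).
  by rewrite -(mul0r (mean A)); apply: cvgMl; apply: cvg_expr; rewrite ger0_norm.
apply: squeeze_cvgr (cvg_cst 0) c0.
by near=> t; rewrite surv_ge0 sth.
Unshelve. all: by end_near. Qed.

(** * Effect of one extra site on the mean, and the variance bound *)

Section Lipschitz.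
Variable tau : R.
Hypothesis tauP : forall z, 1 <= tau * (1 - idla (~: [set z]%SET) (~: [set z]%SET)).
Hypothesis tau_ge0 : 0 <= tau.

(** The expectation of [min (T, n)]: monotonicity and Lipschitz bounds go by induction on [n], then
    pass to the limit [mean]. *)
Let trunc n := iter n (fun u A => (A != top)%:R + \sum_B Qk A B * u B) (fun=> 0).

Let truncS n A : A != top -> trunc n.+1 A = 1 + Q (trunc n) A.
Proof. by move=> AT; rewrite /trunc iterS AT killed_opE. Qed.

Let trunc_top n : trunc n top = 0.
Proof. by case: n => // n; rewrite /trunc iterS eqxx killed_op_top addr0. Qed.

Let trunc_ge0 n A : 0 <= trunc n A.
Proof.
elim: n A => // n IH A; have [->|AT] := eqVneq A top; first by rewrite trunc_top.
by rewrite truncS// addr_ge0// idla_op_ge0.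
Qed.

Let trunc_anti n A z : trunc n (z |: A) <= trunc n A.
Proof.
elim: n A z => // n IH A z.
have [->|AT] := eqVneq A top; first by rewrite finset.setUT.
have [->|zAT] := eqVneq (z |: A) top; first by rewrite trunc_top trunc_ge0.
rewrite !truncS// lerD2l -lerN2.
have QN B : - Q (trunc n) B = Q (fun C => -1 * trunc n C) B.
  by rewrite idla_op_scale mulN1r.
rewrite !QN; apply: (@idla_monotone (fun C => -1 * trunc n C)) => B x.
by rewrite !mulN1r lerN2.
Qed.

(** If [z |: A] is not full, both clusters make a step and the bound is inherited. Otherwise only
    [z] is missing from [A], and the remaining time is geometric with failure probability
    [idla A A]. *)
Let trunc_lip n A z : trunc n A <= trunc n (z |: A) + tau.
Proof.
elim: n A z => [|n IH] A z; first by rewrite add0r.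
have [->|AT] := eqVneq A top; first by rewrite finset.setUT lerDl.
have [zAT|zAT] := eqVneq (z |: A) top; last first.
  by rewrite !truncS// -addrA lerD2l; exact: idla_lipschitz.
rewrite zAT trunc_top add0r truncS//.
have AE : A = (~: [set z])%SET.
  apply/setP => y; rewrite !inE; have := finset.in_setT y.
  rewrite -zAT !inE; have [->|//] := eqVneq y z.
  move=> _; apply: contraNF AT => zA; rewrite -zAT eq_sym.
  by apply/eqP/finset.setUidPr; rewrite finset.sub1set.
have QE : Q (trunc n) A = idla A A * trunc n A.
  rewrite /idla_op (bigD1 A)//= big1 ?addr0// => B BA.
  have [AB|AB] := boolP (A \subset B); last by rewrite idla_sub// mul0r.
  have zB : z \in B.
    apply: contraR BA => zB; rewrite finset.eqEsubset AB andbT AE.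
    by apply/fintype.subsetP => y yB; rewrite !inE; apply: contraNneq zB => <-.
  have -> : B = top.
    apply/eqP; rewrite -finset.subTset -zAT finset.subUset finset.sub1set zB.
    exact: AB.
  by rewrite trunc_top mulr0.
have tA : trunc n A <= tau by have := IH A z; rewrite zAT trunc_top add0r.
(* The goal [1 + q * m <= tau] follows from [m <= tau] and [1 <= tau * (1 - q)]. *)
have := tauP z; rewrite -AE QE; have := idla_ge0 Ksub Knd nuP A A.
by move: (idla A A) (trunc n A) tA => q m; nra.
Qed.

Let trunc_mean n A : trunc n A <= mean A.
Proof.
elim: n A => [|n IH] A; first exact: mean_ge0.
have [->|AT] := eqVneq A top; first by rewrite trunc_top mean_top.
by rewrite truncS// mean_step// lerD2l le_idla_op.
Qed.

Let trunc_cvg A : trunc n A @[n --> \oo] --> mean A.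
Proof.
have [theta /andP[th0 th1] thm] := mean_decay.
have err n B : mean B - trunc n B <= theta ^+ n * mean B.
  elim: n B => [|n IH] B; first by rewrite subr0 mul1r.
  rewrite [X in X - _]meanE /trunc iterS opprD addrACA subrr add0r -sumrB.
  rewrite exprSr -mulrA.
  apply: le_trans (_ : theta ^+ n * \sum_C Qk B C * mean C <= _); last first.
    by rewrite ler_wpM2l ?exprn_ge0.
  rewrite mulr_sumr; apply: ler_sum => C _; rewrite -mulrBr mulrCA.
  by rewrite ler_wpM2l//; have /andP[] := Qk_sub.1 B C.
have c0 : theta ^+ n * mean A @[n --> \oo] --> (0 : R).
  by rewrite -(mul0r (mean A)); apply: cvgMl; apply: cvg_expr; rewrite ger0_norm.
have c1 : mean A - theta ^+ n * mean A @[n --> \oo] --> mean A.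
  by rewrite -[X in _ --> X]subr0; apply: cvgB => //; exact: cvg_cst.
apply: squeeze_cvgr c1 (cvg_cst (mean A)).
near=> n; rewrite trunc_mean andbT lerBlDr -lerBlDl; exact: err.
Unshelve. all: by end_near. Qed.

Lemma mean_anti A z : mean (z |: A) <= mean A.
Proof.
apply: ler_cvg_to (@trunc_cvg (z |: A)) (@trunc_cvg A) _.
by near=> n; exact: trunc_anti.
Unshelve. all: by end_near. Qed.

Lemma mean_lip A z : mean A <= mean (z |: A) + tau.
Proof.
apply: ler_cvg_to (@trunc_cvg A) (cvgD (@trunc_cvg (z |: A)) (cvg_cst tau)) _.
near=> n; exact: trunc_lip.
Unshelve. all: by end_near. Qed.

(** By the maximum principle only one step matters. The drop [D = mean A - mean B] lies in
    [[0, tau]] and has average 1, so [(D - 1)^2 <= (tau - 2) * D + 1] averages to at most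
    [tau - 1]. *)
Lemma var_le A : var A <= tau * mean A.
Proof.
move: A; apply: (max_principle Qk_sub Qk_nd) => A.
have [->|AT] := eqVneq A top.
  by rewrite var_top mean_top mulr0 subrr killed_op_top.
have -> : \sum_B Qk A B * (var B - tau * mean B)
    = \sum_B Qk A B * var B - tau * Q mean A.
  rewrite -killed_opE// mulr_sumr -sumrB; apply: eq_bigr => B _.
  by rewrite mulrBr mulrCA.
have tauE : tau * mean A = tau + tau * Q mean A.
  by rewrite [mean A]mean_step// mulrDr mulr1.
rewrite varE (negPf AT).
suff : Q (fun B => (mean A - 1 - mean B) ^+ 2) A <= tau by lra.
have mA := mean_step AT.
apply: (@le_trans _ _
    (Q (fun B => (2 - tau) * mean B + ((tau - 2) * mean A + 1)) A)); last first.
  by rewrite idla_opDZ idla_op_cst//; move: (Q mean A) (mean A) mA => q m ->; lra.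
apply: le_idla_op => // [|x _]; first by nra.
have := mean_anti A x; have := mean_lip A x.
move: (mean A) (mean (x |: A)) => p q pq qp.
have : 0 <= (p - q) * (q + tau - p) by rewrite mulr_ge0 ?subr_ge0.
by nra.
Qed.

(** After [t] steps an unfilled cluster needs on average at most the time from the empty one:
    [m <= t + m / 2]. *)
Lemma mean_le_half t : surv t finset.set0 <= 2^-1 -> mean finset.set0 <= 2 * t%:R.
Proof.
have mean0 A : mean A <= mean finset.set0.
  rewrite -lerN2; apply: (@le_subset (fun B => - mean B)); last exact: finset.sub0set.
  by move=> B x; rewrite lerN2 mean_anti.
have bound n A : mean A <= mean finset.set0 * surv n A + n%:R.
  elim: n A => [|n IH] A.
    rewrite surv0 addr0; have [->|AT] := eqVneq A top; first by rewrite mean_top mulr0.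
    by rewrite mulr1.
  have [->|AT] := eqVneq A top; first by rewrite mean_top surv_top mulr0 add0r.
  rewrite survS [mean A]mean_step// -natr1 addrA [1 + _]addrC lerD2r.
  apply: le_trans (_ : Q (fun B => mean finset.set0 * surv n B + n%:R) A <= _).
    exact: le_idla_op.
  by rewrite idla_opDZ idla_op_cst.
have := bound t finset.set0; have := mean_ge0 finset.set0.
by move: (mean _) (surv _ _) (t%:R) => m p n; nra.
Qed.

End Lipschitz.

End FillTime.

(** * The ARW chain *)

Section ArwChain.
Variables (R : realType) (V : finType) (K : V -> V -> R) (lambda : R).
Variable nu : V -> R.
Hypotheses (Ksub : substochastic K) (Knd : nondegenerate_kernel K).
Hypothesis lambda_gt0 : 0 < lambda.
Hypotheses (nuP : prob_distribution nu) (Kadm : admissible K nu).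
Implicit Types (eta : conf V) (x y z : V) (A B S : {set V}).

Local Notation T := (topple K lambda).
Local Notation absorb := (absorb K lambda).
Local Notation top := (finset.setT : {set V}).
Local Notation P := (arw_matrix K lambda nu).
Local Notation exit := (exit Ksub Knd).
Local Notation idla := (idla nu Ksub Knd).
Local Notation filled := (filled nu Ksub Knd).

Definition harmonic (h : conf V -> R) : Prop :=
  forall eta x, active eta x -> T x h eta = h eta.

Let absorb_ge0 eta S : 0 <= absorb eta S.
Proof. by have /andP[] := absorb_bounds Ksub lambda_gt0 S eta. Qed.

Let absorb_le1 eta S : absorb eta S <= 1.
Proof. by have /andP[] := absorb_bounds Ksub lambda_gt0 S eta. Qed.

Lemma harmonic_absorb (u : {set V} -> R) :
  harmonic (fun eta => \sum_S absorb eta S * u S).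
Proof.
move=> eta x ax; rewrite topple_sum; apply: eq_bigr => S _.
rewrite -[RHS](congr1 (fun r => r * u S) (absorb_topple Ksub lambda_gt0 S ax)).
by rewrite mulrC -toppleZ; apply: eq_topple => i; rewrite mulrC.
Qed.

Lemma sum_absorb_stable (u : {set V} -> R) S :
  \sum_S' absorb (stable_conf S) S' * u S' = u S.
Proof.
under eq_bigr do rewrite absorb_stable//.
exact: sum_delta.
Qed.

(** The working form of the abelian property: stabilizing before evaluating [h] does not change its
    expectation. *)
Lemma harmonicE (h : conf V -> R) (M : R) : (forall eta, `|h eta| <= M) ->
  harmonic h -> forall eta, h eta = \sum_S absorb eta S * h (stable_conf S).
Proof.
move=> hM hT; apply: (harmonic_eq Ksub Knd lambda_gt0
    (M := M + \sum_(S : {set V}) M)) => // [eta||S].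
- rewrite (le_trans (ler_normB _ _))// lerD//.
  rewrite (le_trans (ler_norm_sum _ _ _))//; apply: ler_sum => S _.
  by rewrite normrM ger0_norm// -[M]mul1r ler_pM.
- exact: (harmonic_absorb (fun S => h (stable_conf S))).
- by rewrite (sum_absorb_stable (fun S => h (stable_conf S))).
Qed.

Lemma harmonic_arrive h x : harmonic h -> harmonic (fun eta => h (arrive eta x)).
Proof.
move=> hT eta y ay; rewrite -topple_arrive// hT//.
by rewrite /active ffunE; case: eqP => // <-; case: (eta y).
Qed.

Lemma absorb_sum eta : \sum_S absorb eta S = 1.
Proof.
have b1 (xi : conf V) : `|1 : R| <= 1 by rewrite normr1.
have h1 : harmonic (fun=> 1) by move=> xi x _; exact: topple_cst.
have e := @harmonicE (fun=> 1) 1 b1 h1 eta.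
by rewrite [RHS]e; apply: eq_bigr => S _; rewrite mulr1.
Qed.

(** With a second particle at [x] a sleep instruction is void; discarding it removes [lambda] from
    the equation. *)
Lemma harmonic_jump h eta x : harmonic h -> active eta x ->
  h (arrive eta x) = kill K x * h eta + \sum_y K x y * h (arrive eta y).
Proof.
move=> hT ax; have ax' : active (arrive eta x) x.
  by rewrite /active ffunE eqxx; case: (eta x).
have := hT _ _ ax'; rewrite toppleE depart_arrive ?active_neq0// sleep_arrive//.
set S1 := \sum_y _; rewrite -/(kill K x) => e.
have l1 : 1 + lambda != 0 by rewrite gt_eqF// addr_gt0.
move: e => /(congr1 (fun r => (1 + lambda) * r)); rewrite mulVKf//; lra.
Qed.

(** On a full configuration a surplus particle never finds itself alone, so it can walk until it is
    killed; surpluses are removed one by one. *)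
Lemma harmonic_full h eta : harmonic h -> (forall x, active eta x) ->
  h eta = h (act_conf top).
Proof.
move=> hT; have [n] := ubnP (count eta); elim: n eta => // n IH eta cn full.
have [/forallP one|/forallPn[x ex]] := boolP [forall x, eta x == Some 1%N].
  by congr h; apply/ffunP => x; rewrite ffunE inE; apply/eqP.
have [k exk] : exists k, eta x = Some k.+2.
  have := full x; move: ex; rewrite /active; case: (eta x) => [[|[|k]]|]//= _ _.
  by exists k.
pose xi := depart eta x.
have etaE : eta = arrive xi x.
  by apply/ffunP => y; rewrite !ffunE eqxx exk /=; case: eqP => [->|].
have fxi y : active xi y.
  rewrite /active ffunE; case: eqP => [_|_]; [by rewrite exk|exact: full].
rewrite -(IH xi) => //; last first.
  by move: cn; rewrite etaE count_arrive ltnS.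
rewrite etaE; apply: (kernel_eq Ksub Knd (b := fun y => kill K y * h xi)
  (f := fun y => h (arrive xi y)) (g := fun=> h xi)) => y.
  exact: harmonic_jump.
by rewrite -mulr_suml -mulrDl subrK mul1r.
Qed.

Lemma harmonic_exit h A x : harmonic h ->
  h (arrive (act_conf A) x) = exit A (fun B => h (act_conf B)) x.
Proof.
move=> hT; move: x; apply: exit_eq => x xA; first by rewrite arrive_act_conf.
by apply: harmonic_jump; rewrite ?act_conf_active.
Qed.

Definition pow t S S' : R := (P ^+ t) (enum_rank S) (enum_rank S').

Lemma sum_enum_rank (u : 'I_#|{set V}| -> R) :
  \sum_i u i = \sum_(S : {set V}) u (enum_rank S).
Proof.
rewrite (reindex (@enum_rank {set V}))//=.
by exists enum_val => i _; [exact: enum_rankK|exact: enum_valK].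
Qed.

Lemma pow0 S S' : pow 0 S S' = (S == S')%:R.
Proof. by rewrite /pow expr0 mxE (inj_eq enum_rank_inj). Qed.

Lemma powS t S S' : pow t.+1 S S' =
  \sum_x nu x * \sum_B absorb (arrive (stable_conf S) x) B * pow t B S'.
Proof.
rewrite /pow exprS mxE sum_enum_rank.
under eq_bigr => B _ do rewrite mxE !enum_rankK mulr_suml.
rewrite exchange_big/=; apply: eq_bigr => x _; rewrite mulr_sumr.
by apply: eq_bigr => B _; rewrite stabilizationE// mulrA.
Qed.

(* Law, after [t] further steps, of the chain whose initial state is the
   stabilization of [eta]. *)
Definition law t eta S : R := \sum_B absorb eta B * pow t B S.

Lemma law_harmonic t S : harmonic (law t ^~ S).
Proof. exact: harmonic_absorb. Qed.

Lemma law_stable t S S' : law t (stable_conf S) S' = pow t S S'.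
Proof. exact: (sum_absorb_stable (fun B => pow t B S')). Qed.

Lemma law0 eta S : law 0 eta S = absorb eta S.
Proof.
rewrite /law; under eq_bigr do rewrite pow0 mulrC eq_sym.
exact: sum_delta.
Qed.

(** [eta] need not be stabilized before the next particle is added: adding a particle preserves
    harmonicity, so [harmonicE] applies. *)
Lemma lawS t eta S : law t.+1 eta S = \sum_x nu x * law t (arrive eta x) S.
Proof.
pose M := \sum_B `|pow t B S|.
have lawM xi : `|law t xi S| <= M.
  rewrite (le_trans (ler_norm_sum _ _ _))//; apply: ler_sum => B _.
  by rewrite normrM ger0_norm// ler_piMl.
rewrite /law; under eq_bigr do rewrite powS mulr_sumr.
rewrite exchange_big/=; apply: eq_bigr => x _.
have hx := @harmonic_arrive _ x (@law_harmonic t S).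
rewrite -/(law t (arrive eta x) S).
rewrite (harmonicE (fun xi => lawM (arrive xi x)) hx) mulr_sumr.
by apply: eq_bigr => B _; rewrite mulrCA.
Qed.

Lemma law_ge0 t eta S : 0 <= law t eta S.
Proof.
elim: t eta => [|t IH] eta; first by rewrite law0.
rewrite lawS; apply: sumr_ge0 => x _; rewrite mulr_ge0//; exact: nuP.1.
Qed.

Lemma law_sum t eta : \sum_S law t eta S = 1.
Proof.
elim: t eta => [|t IH] eta.
  by under eq_bigr do rewrite law0; exact: absorb_sum.
under eq_bigr do rewrite lawS.
rewrite exchange_big/=; under eq_bigr do rewrite -mulr_sumr IH mulr1.
exact: nuP.2.
Qed.

(* Stabilizing the configuration with one active particle per site samples the
   invariant distribution exactly (Levine and Liang). *)
Definition inv_dist S : R := absorb (act_conf top) S.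

Lemma law_full t eta S : (forall x, active eta x) -> law t eta S = inv_dist S.
Proof.
move=> full; elim: t eta full => [|t IH] eta full.
  rewrite law0; apply: (@harmonic_full (absorb^~ S)) => //.
  by move=> xi x ax; exact: absorb_topple.
rewrite lawS.
under eq_bigr => x _.
  rewrite IH; last first.
    move=> y; have := full y; rewrite /active arriveE.
    by case: eqP => [<-|//]; case: (eta y).
  over.
by rewrite -mulr_suml nuP.2 mul1r.
Qed.

(** IDLA runs on top of any [eta]: a particle leaving [A] at [x] makes [x] active whatever it held,
    so [eta] stays active on the cluster; once the cluster is full, [law_full] gives the exact
    law. *)
Lemma law_ge t eta A S : (forall x, x \in A -> active eta x) ->
  filled t A * inv_dist S <= law t eta S.
Proof.
elim: t eta A => [|t IH] eta A etaA.
  rewrite filled0; have [AT|_] := eqVneq A top; last by rewrite mul0r law_ge0.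
  by rewrite mul1r law_full// => x; apply: etaA; rewrite AT inE.
rewrite filledS lawS idla_opE mulr_suml; apply: ler_sum => x _.
rewrite -mulrA ler_wpM2l//; first exact: nuP.1.
rewrite mulrC -[X in X <= _]addr0.
have <- : exit A (fun B => inv_dist S * filled t B) x = inv_dist S * exit A (filled t) x + 0.
  rewrite addr0 /exit mulr_sumr; apply: eq_bigr => B _; by rewrite mulrCA.
move: x; apply: exit_le => x xA.
  rewrite mulrC; apply: IH => y; rewrite !inE /active arriveE.
  case: eqP => [-> _|_ /= yA]; first by case: (eta x).
  by have := etaA y yA; rewrite /active.
rewrite (harmonic_jump (@law_harmonic t S) (etaA x xA)) lerD2r.
by rewrite ler_wpM2l ?kill_ge0// mulrC; exact: IH.
Qed.

Lemma law_act_conf t A : law t (act_conf A) top = filled t A * inv_dist top.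
Proof.
elim: t A => [|t IH] A.
  rewrite law0 filled0; have [->|AT] := eqVneq A top; first by rewrite mul1r.
  rewrite mul0r absorb_count//; apply: (@leq_ltn_trans #|A|); last first.
    by rewrite proper_card// finset.properT.
  rewrite -sum1_card [X in (_ <= X)%N]big_mkcond /count.
  by apply: leq_sum => x _; rewrite ffunE; case: (x \in A).
rewrite lawS filledS idla_opE mulr_suml; apply: eq_bigr => x _.
rewrite (harmonic_exit _ _ (@law_harmonic t top)) -mulrA; congr (_ * _).
by rewrite /exit mulr_suml; apply: eq_bigr => B _; rewrite IH mulrA.
Qed.

Lemma absorb_gt0_asleep eta : (forall x, nactive (eta x) <= 1)%N ->
  0 < absorb eta [set x | eta x != Some 0%N]%SET.
Proof.
have [n] := ubnP (\sum_x nactive (eta x))%N; elim: n eta => // n IH eta cn eta1.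
have [/stableP[S etaS]|/forallPn[x]] := boolP [forall x, ~~ active eta x].
  rewrite (_ : [set x | _]%SET = S) ?etaS ?absorb_stable ?eqxx//.
  by apply/setP => x; rewrite inE ffunE; case: (x \in S).
rewrite negbK => ax; set S := [set y | _]%SET.
have ex : eta x = Some 1%N.
  by have := eta1 x; move: ax; rewrite /active; case: (eta x) => [[|[]]|].
pose xi := fall_asleep eta x.
have xiS : S = [set y | xi y != Some 0%N]%SET.
  by apply/setP => y; rewrite !inE ffunE; have [->|//] := eqVneq y x; rewrite ex.
have xi1 y : (nactive (xi y) <= 1)%N by rewrite ffunE; case: eqP.
have cxi : (\sum_y nactive (xi y) < n)%N.
  move: cn; rewrite (bigD1 x)//= ex ltnS => /(leq_trans _); apply.
  rewrite (bigD1 x)//= ffunE eqxx add0n add1n ltnS.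
  by apply: leq_sum => y /negPf yx; rewrite ffunE yx.
have := IH xi cxi xi1; rewrite -xiS => xi_gt0.
rewrite -(absorb_topple Ksub lambda_gt0 S ax) /topple (bigD1 None)//=.
rewrite ltr_wpDr//.
  by apply: sumr_ge0 => i _; rewrite mulr_ge0// weight_ge0.
by rewrite ex eqxx mulr_gt0// divr_gt0// addr_gt0.
Qed.

(** Particles outside [S] are led to their death one at a time, then the others fall asleep. If this
    failed for a particle at [x], the zeros of [f] would be free of killing and closed under [K],
    against non-degeneracy. *)
Lemma inv_dist_gt0 S : 0 < inv_dist S.
Proof.
suff gt A : S \subset A -> 0 < absorb (act_conf A) S.
  by apply: gt; exact: finset.subsetT.
have [n] := ubnP #|A :\: S|; elim: n A => // n IH A cn SA.
have [AS|/subsetPn[x xA xS]] := boolP (A \subset S).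
  have -> : A = S by apply/eqP; rewrite finset.eqEsubset AS.
  have := @absorb_gt0_asleep (act_conf S); rewrite (_ : [set _ | _]%SET = S).
    by apply => x; rewrite ffunE; case: (x \in S).
  by apply/setP => x; rewrite inE ffunE; case: (x \in S).
pose B := A :\ x.
have xB : x \notin B by rewrite !inE eqxx.
have BA : x |: B = A by rewrite finset.setD1K.
have B_gt0 : 0 < absorb (act_conf B) S.
  apply: IH.
    rewrite -ltnS (leq_trans _ cn)// ltnS; apply: proper_card.
    apply/properP; split; first by rewrite finset.setSD// subD1set.
    by exists x; rewrite !inE ?eqxx ?xS.
  by rewrite subsetD1 SA.
rewrite -BA -arrive_act_conf//.
pose f y := absorb (arrive (act_conf B) y) S.
have f_ge0 y : 0 <= f y by exact: absorb_ge0.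
have K_ge0 y z : 0 <= K y z by have /andP[] := Ksub.1 y z.
rewrite lt_neqAle absorb_ge0 andbT eq_sym -/(f x); apply/negP => fx0.
apply: (Knd (A := [set y | f y == 0]%SET)).
  by apply/set0Pn; exists x; rewrite inE.
move=> y; rewrite inE => /eqP fy0.
have ay : active (arrive (act_conf B) y) y by rewrite /active !ffunE eqxx.
have := absorb_topple Ksub lambda_gt0 S ay.
rewrite toppleE depart_arrive; last by rewrite ffunE.
rewrite -/(f y) -/(kill K y) fy0 => /eqP; rewrite mulf_eq0 invr_eq0 gt_eqF ?addr_gt0//=.
have s1 : 0 <= \sum_z K y z * f z.
  by apply: sumr_ge0 => z _; rewrite mulr_ge0.
have s2 : 0 <= kill K y * absorb (act_conf B) S by rewrite mulr_ge0 ?kill_ge0.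
rewrite paddr_eq0 ?addr_ge0 ?mulr_ge0 ?(ltW lambda_gt0)//.
rewrite paddr_eq0// => /andP[/andP[/eqP sum0 k0] _].
have {k0} K1 : \sum_z K y z = 1.
  by move: k0; rewrite mulf_eq0 (gt_eqF B_gt0) orbF subr_eq0 => /eqP.
rewrite -[RHS]K1 [RHS](bigID (mem [set z | f z == 0]%SET))/= [X in _ + X]big1 ?addr0//.
move=> z; rewrite inE => fz; move/eqP: sum0; rewrite psumr_eq0 => [|t _].
  move/allP => /(_ z (mem_index_enum _)); rewrite mulf_eq0 (negPf fz) orbF.
  by move/eqP.
by rewrite mulr_ge0.
exact: kill_ge0.
Qed.

(* From the cluster [V \ z], IDLA either stays there or jumps to [V], whose stabilization
   is invariant; the difference of the two laws is thus an eigenvector, whose eigenvalue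
   is the probability of not visiting [z]. *)
Lemma eigenvector_setC1 z S : let A := (~: [set z])%SET in
  law 1 (act_conf A) S - law 1 (act_conf top) S
  = idla A A * (absorb (act_conf A) S - inv_dist S).
Proof.
move=> A; have AT : A != top.
  by apply/eqP => /setP/(_ z); rewrite !inE eqxx.
rewrite (@law_full 1 (act_conf top)); last by move=> x; rewrite act_conf_active inE.
have -> : law 1 (act_conf A) S = idla_op nu Ksub Knd (fun B => absorb (act_conf B) S) A.
  rewrite lawS idla_opE; apply: eq_bigr => x _; rewrite law0; congr (_ * _).
  apply: (@harmonic_exit (absorb ^~ S)) => eta y ay; exact: absorb_topple.
have supA B : A \subset B -> B != A -> B = top.
  move=> AB BA; apply/eqP; rewrite -finset.subTset; apply/fintype.subsetP => y _.
  have [->|yz] := eqVneq y z; last by apply: (fintype.subsetP AB); rewrite !inE.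
  apply: contraR BA => zB; rewrite finset.eqEsubset AB andbT.
  by apply/fintype.subsetP => t tB; rewrite !inE; apply: contraNneq zB => <-.
have sum2 (u : {set V} -> R) :
    idla_op nu Ksub Knd u A = idla A A * u A + idla A top * u top.
  rewrite /idla_op (bigD1 A)//= (bigD1 top) 1?eq_sym//= big1 ?addr0// => B /andP[BA BT].
  have [AB|AB] := boolP (A \subset B); last by rewrite idla_sub ?mul0r.
  by rewrite (supA B AB BA) eqxx in BT.
have := sum2 (fun=> 1); rewrite idla_op_cst// sum2 -/(inv_dist S) => e.
have -> : idla A top = 1 - idla A A by lra.
by ring.
Qed.

End ArwChain.

(** * Separation distance and spectrum *)

Section SeparationDistance.
Variables (R : realType) (n : nat) (P : 'M[R]_n) (mu : 'rV[R]_n) (p : nat -> R).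
Hypotheses (mu_gt0 : forall j, 0 < mu 0 j) (mu_inv : invariant_distribution P mu).
Hypothesis P_sum : forall i, \sum_j P i j = 1.
Hypothesis P_ge : forall t i j, (1 - p t) * mu 0 j <= (P ^+ t) i j.
Hypothesis P_eq : exists i j, forall t, (P ^+ t) i j = (1 - p t) * mu 0 j.
Hypothesis p_cvg0 : p t @[t --> \oo] --> (0 : R).

Lemma sum_pow t i : \sum_j (P ^+ t) i j = 1.
Proof.
elim: t i => [|t IH] i.
  rewrite expr0 (bigD1 i)//= mxE eqxx big1 ?addr0// => j.
  by rewrite mxE eq_sym => /negPf ->.
rewrite exprS; under eq_bigr do rewrite mxE.
by rewrite exchange_big/=; under eq_bigr do rewrite -mulr_sumr IH mulr1.
Qed.

Lemma invariant_pow (v : 'rV[R]_n) t : v *m P = v -> v *m (P ^+ t) = v.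
Proof.
move=> vP; elim: t => [|t IH]; first by rewrite expr0 mulmx1.
by rewrite exprS mulmxA vP IH.
Qed.

(** Any invariant law dominates [(1 - p t) * mu] for all [t], hence [mu], and has the same total
    mass. *)
Lemma stationaryE : stationary P = mu.
Proof.
apply: xget_unique => //= nu [nu0 nu1 nuP].
have [mu0 mu1 muP] := mu_inv.
have le j : mu 0 j <= nu 0 j.
  have cvg : (1 - p t) * mu 0 j @[t --> \oo] --> (1 - 0) * mu 0 j.
    by apply: cvgMl; apply: cvgB => //; exact: cvg_cst.
  rewrite subr0 mul1r in cvg.
  apply: ler_cvg_to cvg (cvg_cst (nu 0 j)) _; near=> t.
  rewrite -[in leRHS](invariant_pow t nuP) mxE.
  apply: (@le_trans _ _ (\sum_i nu 0 i * ((1 - p t) * mu 0 j))).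
    by rewrite -mulr_suml nu1 mul1r.
  by apply: ler_sum => i _; rewrite ler_wpM2l.
have /eqP : \sum_j (nu 0 j - mu 0 j) = 0 by rewrite sumrB nu1 mu1 subrr.
rewrite psumr_eq0 => [/allP eq0|j _]; last by rewrite subr_ge0.
apply/rowP => j; have := eq0 j (mem_index_enum _).
by rewrite subr_eq0 => /eqP.
Unshelve. all: by end_near. Qed.

Lemma d_sepE t : d_sep P t = p t.
Proof.
have [i0 [j0 P0]] := P_eq.
have ub : ubound [set 1 - (P ^+ t) ij.1 ij.2 / stationary P 0 ij.2 | ij in
    [set: 'I_n * 'I_n]] (p t).
  move=> _ [[i j] _ <-] /=; rewrite stationaryE lerBlDr -lerBlDl.
  by rewrite ler_pdivlMr.
have p_in : [set 1 - (P ^+ t) ij.1 ij.2 / stationary P 0 ij.2 | ij in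
    [set: 'I_n * 'I_n]] (p t).
  exists (i0, j0) => //=; rewrite stationaryE P0 mulfK ?gt_eqF//.
  by ring.
apply/le_anti/andP; split; first by apply: ge_sup => //; exists (p t).
by apply: ub_le_sup => //; exists (p t).
Qed.

Lemma d_sep_ge0 t : 0 <= p t.
Proof.
have [i [j Pij]] := P_eq.
have : \sum_j (1 - p t) * mu 0 j <= \sum_j (P ^+ t) i j by exact: ler_sum.
have [_ mu1 _] := mu_inv.
by rewrite sum_pow -mulr_sumr mu1 mulr1 lerBlDr lerDl.
Qed.

(* [P ^+ t] is [(1 - p t) 1 mu] plus a matrix with nonnegative entries and row sums
   [p t]; a left eigenvector for [z != 1] has vanishing sum, so that only the
   latter acts on it. *)
Lemma eigenvalue_le_d_sep (z : R[i]) t : z != 1 ->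
  eigenvalue (map_mx (real_complex R) P) z -> (complex.Re `|z|) ^+ t <= p t.
Proof.
move=> z1 /eigenvalueP[v vP v0].
pose Pc s := map_mx (real_complex R) (P ^+ s).
have vPt s : v *m Pc s = z ^+ s *: v.
  elim: s => [|s IH]; first by rewrite /Pc expr0 map_mx1 mulmx1 scale1r.
  rewrite /Pc exprS map_mxM mulmxA vP -scalemxAl -[map_mx _ _]/(Pc s) IH.
  by rewrite scalerA -exprS.
have sumPc s i : \sum_j Pc s i j = 1.
  under eq_bigr do rewrite mxE.
  by rewrite -rmorph_sum sum_pow rmorph1.
have sumv : \sum_j v 0 j = 0.
  have : \sum_j (v *m Pc 1%N) 0 j = z * \sum_j v 0 j.
    by rewrite vPt expr1 mulr_sumr; apply: eq_bigr => j _; rewrite mxE.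
  under eq_bigr do rewrite mxE.
  rewrite exchange_big/=; under eq_bigr do rewrite -mulr_sumr sumPc mulr1.
  move=> /eqP; rewrite -subr_eq0 -{1}[\sum_i _]mul1r -mulrBl mulf_eq0 subr_eq0.
  by rewrite eq_sym (negPf z1) => /eqP.
pose D i j : R[i] := real_complex R ((P ^+ t) i j - (1 - p t) * mu 0 j).
have D0 i j : 0 <= D i j by rewrite ler0c subr_ge0.
have sumD i : \sum_j D i j = real_complex R (p t).
  rewrite -rmorph_sum sumrB sum_pow -mulr_sumr; have [_ -> _] := mu_inv.
  by apply: congr1; ring.
have vD j : (z ^+ t) * v 0 j = \sum_i v 0 i * D i j.
  under eq_bigr do rewrite /D rmorphB mulrBr.
  rewrite sumrB -mulr_suml sumv mul0r subr0.
  have := congr1 (fun w : 'rV_n => w 0 j) (vPt t); rewrite !mxE => <-.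
  by apply: eq_bigr => i _; rewrite mxE.
pose N := \sum_j `|v 0 j|.
have N0 : 0 < N.
  rewrite lt_neqAle sumr_ge0// andbT eq_sym; apply: contra v0.
  rewrite psumr_eq0// => /allP v0; apply/eqP/rowP => j; rewrite mxE.
  by apply/eqP; have := v0 j (mem_index_enum _); rewrite normr_eq0.
have : `|z| ^+ t * N <= real_complex R (p t) * N.
  rewrite /N !mulr_sumr (@le_trans _ _ (\sum_j \sum_i `|v 0 i| * D i j))//.
    apply: ler_sum => j _; rewrite -normrX -normrM vD.
    rewrite (le_trans (ler_norm_sum _ _ _))//; apply: ler_sum => i _.
    by rewrite normrM (ger0_norm (D0 _ _)).
  rewrite exchange_big/=; apply: ler_sum => i _.
  by rewrite -mulr_sumr sumD mulrC.
rewrite ler_pM2r//.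
have <- : real_complex R (complex.Re `|z|) = `|z|.
  by apply: RRe_real; rewrite normr_real.
by rewrite -rmorphXn /= lecR.
Qed.

(** * The second largest modulus of an eigenvalue *)

Section Rho.
Variables (q : R) (w : 'rV[R]_n).
Hypotheses (q_ge0 : 0 <= q) (q_lt1 : q < 1) (w_neq0 : w != 0).
Hypothesis w_eigen : w *m P = q *: w.

Lemma eigen_in_spectrum : [set complex.Re `|z| | z in
    [set z : R[i] | z != 1 /\ eigenvalue (map_mx (real_complex R) P) z]] q.
Proof.
exists (real_complex R q); last by rewrite ger0_norm ?ler0c.
split; first by rewrite (inj_eq (@complexI R)) lt_eqF.
apply/eigenvalueP; exists (map_mx (real_complex R) w).
  by rewrite -map_mxM w_eigen map_mxZ.
by rewrite map_mx_eq0.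
Qed.

Let spectrum_bound t (e : R) : [set complex.Re `|z| | z in
    [set z : R[i] | z != 1 /\ eigenvalue (map_mx (real_complex R) P) z]] e ->
  0 <= e /\ e ^+ t <= p t.
Proof.
move=> [z [z1 zE] <-]; split; last exact: eigenvalue_le_d_sep.
by rewrite -ler0c RRe_real ?normr_real.
Qed.

Let spectrum_has_sup : has_sup [set complex.Re `|z| | z in
    [set z : R[i] | z != 1 /\ eigenvalue (map_mx (real_complex R) P) z]].
Proof.
split; first by exists q; exact: eigen_in_spectrum.
by exists (p 1%N) => e /(spectrum_bound 1)[_]; rewrite expr1.
Qed.

Lemma rho_ge : q <= rho P.
Proof. by apply: ub_le_sup; [exact: spectrum_has_sup.2|exact: eigen_in_spectrum]. Qed.

Lemma rho_pow_le t : rho P ^+ t <= p t.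
Proof.
have [->|t0] := eqVneq t 0%N.
  rewrite expr0; have [_] := spectrum_bound 0 eigen_in_spectrum.
  by rewrite expr0.
(* [rho] is a supremum: the bound on each [t]-th power is transferred to it through the [t]-th
   root. *)
pose b := p t `^ (t%:R^-1).
have bt : b ^+ t = p t.
  rewrite -powR_mulrn ?powR_ge0// -powRrM mulVf ?pnatr_eq0//.
  by rewrite powRr1// d_sep_ge0.
rewrite -bt lerXn2r ?nnegrE ?powR_ge0 ?(le_trans q_ge0 rho_ge)//.
apply: ge_sup; first by exists q; exact: eigen_in_spectrum.
move=> e /(spectrum_bound t)[e0 et].
by rewrite -(ler_pXn2r (n := t)) ?nnegrE ?powR_ge0 ?bt// lt0n.
Qed.

Lemma rho_lt1 : rho P < 1.
Proof.
have [t pt] : exists t, p t < 1.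
  have [t _ pt] := cvgr_lt _ p_cvg0 _ (@ltr01 R).
  by exists t; apply: pt => /=.
rewrite ltNge; apply/negP => r1.
by have := le_lt_trans (rho_pow_le t) pt; rewrite ltNge exprn_ege1.
Qed.

Lemma t_rel_ge1 : 1 <= t_rel P * (1 - q).
Proof.
have r1 := rho_lt1; rewrite /t_rel mulrC ler_pdivlMr ?subr_gt0//.
by rewrite mul1r lerD2l lerN2 rho_ge.
Qed.

End Rho.

Lemma t_sepP eps : 0 < eps -> exists N : nat,
  [/\ t_sep P eps = N%:R, p N <= eps & forall k, (k < N)%N -> eps < p k].
Proof.
move=> eps0.
have exN : exists N, p N <= eps.
  have [t _ pt] := cvgr_le _ p_cvg0 _ eps0.
  by exists t; apply: pt => /=.
have [N pN Nmin] := ex_minnP exN; exists N; split => //; last first.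
  by move=> k kN; rewrite ltNge; apply: contraL kN => /Nmin; rewrite -leqNgt.
have inE : [set t%:R | t in [set t : nat | d_sep P t <= eps]] (N%:R : R).
  by exists N => //=; rewrite d_sepE.
have lb : lbound [set t%:R | t in [set t : nat | d_sep P t <= eps]] (N%:R : R).
  by move=> _ [t /= + <-]; rewrite d_sepE => /Nmin; rewrite ler_nat.
apply/le_anti/andP; split; first by apply: ge_inf => //; exists N%:R.
by apply: lb_le_inf => //; exists N%:R.
Qed.

End SeparationDistance.

(** * Separation distance of the ARW chain *)

Section ArwSeparation.
Variables (R : realType) (V : finType) (K : V -> V -> R) (lambda : R).
Variable nu : V -> R.
Hypothesis V_gt0 : (0 < #|V|)%N.
Hypotheses (Ksub : substochastic K) (Knd : nondegenerate_kernel K).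
Hypothesis lambda_gt0 : 0 < lambda.
Hypotheses (nuP : prob_distribution nu) (Kadm : admissible K nu).
Implicit Types (x y z : V) (A B S : {set V}).

Local Notation top := (finset.setT : {set V}).
Local Notation P := (arw_matrix K lambda nu).
Local Notation idla := (idla nu Ksub Knd).
Local Notation filled := (filled nu Ksub Knd).
Local Notation surv := (surv nu Ksub Knd).
Local Notation law := (law K lambda nu).
Local Notation inv_dist := (inv_dist K lambda).
Local Notation d := (d_sep P).

Let mu : 'rV[R]_#|{set V}| := \row_j inv_dist (enum_val j).
Let p t : R := surv t finset.set0.

Let filledE t : filled t finset.set0 = 1 - p t.
Proof. by rewrite /p /surv opprB addrC subrK. Qed.

Let mu_gt0 j : 0 < mu 0 j.
Proof. by rewrite mxE; exact: inv_dist_gt0. Qed.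

Lemma row_mul_arw (v : {set V} -> R) (j : 'I_#|{set V}|) :
  ((\row_i v (enum_val i)) *m P) 0 j = \sum_B v B * pow K lambda nu 1 B (enum_val j).
Proof.
rewrite mxE sum_enum_rank; apply: eq_bigr => B _.
by rewrite mxE enum_rankK /pow expr1 enum_valK.
Qed.

Let mu_inv : invariant_distribution P mu.
Proof.
split=> [j||]; first exact: ltW.
- rewrite sum_enum_rank; under eq_bigr do rewrite mxE enum_rankK.
  exact: absorb_sum.
- apply/rowP => j; rewrite row_mul_arw mxE.
  by apply: (@law_full _ _ _ _ _ Ksub Knd lambda_gt0 nuP 1) => x; rewrite act_conf_active inE.
Qed.

Let powE t i j : (P ^+ t) i j = law t (stable_conf (enum_val i)) (enum_val j).
Proof. by rewrite law_stable// /pow !enum_valK. Qed.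

Let P_sum i : \sum_j P i j = 1.
Proof.
rewrite -[P]expr1; under eq_bigr do rewrite powE.
rewrite sum_enum_rank; under eq_bigr do rewrite enum_rankK.
exact: law_sum.
Qed.

Let P_ge t i j : (1 - p t) * mu 0 j <= (P ^+ t) i j.
Proof.
by rewrite powE mxE -filledE; apply: law_ge => // x; rewrite inE.
Qed.

Let P_eq : exists i j, forall t, (P ^+ t) i j = (1 - p t) * mu 0 j.
Proof.
exists (enum_rank finset.set0), (enum_rank top) => t.
by rewrite powE mxE !enum_rankK -act_conf0 law_act_conf// filledE.
Qed.

Let p_cvg0 : p t @[t --> \oo] --> (0 : R).
Proof. exact: surv_cvg0. Qed.

Lemma arw_d_sep t : d t = surv t finset.set0.
Proof. exact: (d_sepE mu_gt0 mu_inv P_ge P_eq p_cvg0). Qed.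

Lemma arw_eigen z : let A := (~: [set z])%SET in
  exists2 w : 'rV[R]_#|{set V}|, w != 0 & w *m P = idla A A *: w.
Proof.
move=> A; pose v S := absorb K lambda (act_conf A) S - inv_dist S.
have AT : A != top by apply/eqP => /setP/(_ z); rewrite !inE eqxx.
exists (\row_i v (enum_val i)).
  (* The vector is non-zero at the full configuration, which [#|V| - 1] particles cannot reach but
     which has positive invariant mass. *)
  apply/eqP => /rowP/(_ (enum_rank top)); rewrite !mxE enum_rankK /v => /eqP.
  rewrite -(law0 K lambda nu) law_act_conf// filled0 (negPf AT) mul0r sub0r.
  by rewrite oppr_eq0 gt_eqF// inv_dist_gt0.
apply/rowP => j; rewrite row_mul_arw [RHS]mxE [X in _ * X]mxE.
rewrite /v -(eigenvector_setC1 Ksub Knd lambda_gt0 nuP) /law -sumrB.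
by apply: eq_bigr => B _; rewrite mulrBl.
Qed.

Let idla_setC1 z : idla (~: [set z])%SET (~: [set z])%SET < 1.
Proof.
by apply: idla_lt1 => //; apply/eqP => /setP/(_ z); rewrite !inE eqxx.
Qed.

Lemma arw_rho t : 0 <= rho P < 1 /\ rho P ^+ t <= d t.
Proof.
have /card_gt0P[z _] := V_gt0; have [w w0 wE] := arw_eigen z.
rewrite arw_d_sep.
have q0 := idla_ge0 Ksub Knd nuP (~: [set z])%SET (~: [set z])%SET.
have q1 := idla_setC1 z.
have rho_q := rho_ge mu_inv P_sum P_ge q0 q1 w0 wE.
split; last exact: (rho_pow_le mu_inv P_sum P_ge P_eq q0 q1 w0 wE).
by rewrite (le_trans q0 rho_q) (rho_lt1 mu_inv P_sum P_ge P_eq p_cvg0 q0 q1 w0 wE).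
Qed.

Let rho01 : 0 <= rho P < 1. Proof. by have [] := arw_rho 0. Qed.

Lemma arw_t_rel_gt0 : 0 < t_rel P.
Proof. by have /andP[_ r1] := rho01; rewrite invr_gt0 subr_gt0. Qed.

Lemma arw_t_rel_ge z : 1 <= t_rel P * (1 - idla (~: [set z])%SET (~: [set z])%SET).
Proof.
have [w w0 wE] := arw_eigen z.
have q0 := idla_ge0 Ksub Knd nuP (~: [set z])%SET (~: [set z])%SET.
exact: (t_rel_ge1 mu_inv P_sum P_ge P_eq p_cvg0 q0 (idla_setC1 z) w0 wE).
Qed.

Lemma arw_t_sepP eps : 0 < eps -> exists N : nat,
  [/\ t_sep P eps = N%:R, d N <= eps & forall k, (k < N)%N -> eps < d k].
Proof.
move=> eps0; have [N [NE dN Nmin]] := t_sepP mu_gt0 mu_inv P_ge P_eq p_cvg0 eps0.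
by exists N; rewrite NE arw_d_sep; split=> // k /Nmin; rewrite arw_d_sep.
Qed.

Lemma arw_d_sep0 : d 0 = 1.
Proof.
rewrite arw_d_sep surv0; case: eqP => // /setP e0.
by have /card_gt0P[z _] := V_gt0; have := e0 z; rewrite !inE.
Qed.

Lemma arw_d_sep_ge0 t : 0 <= d t.
Proof. by rewrite arw_d_sep surv_ge0. Qed.

Lemma arw_d_sep_noninc s t : (s <= t)%N -> d t <= d s.
Proof.
move=> st; rewrite -(subnK st); elim: (t - s)%N => // k; apply: le_trans.
by rewrite addSn !arw_d_sep lerD2l lerN2 filled_leS.
Qed.

Lemma arw_d_sep_le1 t : d t <= 1.
Proof. by rewrite -arw_d_sep0 arw_d_sep_noninc. Qed.

Lemma arw_t_sep_anti a b : 0 < a -> a <= b -> t_sep P b <= t_sep P a.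
Proof.
move=> a0 ab; have b0 := lt_le_trans a0 ab.
have [M [-> dM _]] := arw_t_sepP a0; have [N [-> _ Nmin]] := arw_t_sepP b0.
rewrite ler_nat leqNgt; apply/negP => /Nmin; rewrite ltNge.
by rewrite (le_trans dM ab).
Qed.

Lemma arw_t_sep_gt0 : 0 < t_sep P 2^-1.
Proof.
have [N [-> dN _]] := @arw_t_sepP 2^-1 ltac:(by rewrite invr_gt0).
rewrite ltr0n lt0n; apply: contraTneq dN => ->.
by rewrite arw_d_sep0 -ltNge; lra.
Qed.

(** With [N1 = t_sep eps] and [N2 = t_sep (1 - eps)], both [T >= N1] and [T <= N2] have probability
    at least [eps], so Chebyshev's inequality bounds the distance of each from the mean. *)
Lemma arw_window eps : 0 < eps -> eps < 2^-1 ->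
  t_sep P eps - t_sep P (1 - eps) <= Num.sqrt (8 * t_rel P * t_sep P 2^-1 / eps).
Proof.
move=> eps0 eps1.
have eps0' : 0 < 1 - eps by lra.
have half0 : 0 < 2^-1 :> R by rewrite invr_gt0.
pose m := mean Ksub Knd nuP Kadm finset.set0; pose W := var Ksub Knd nuP Kadm finset.set0.
have tr0 := arw_t_rel_gt0.
have Wm : W <= t_rel P * m by apply: var_le => //; [exact: arw_t_rel_ge|exact: ltW].
have [h [hE dh _]] := arw_t_sepP half0.
have mh : m <= 2 * h%:R.
  by apply: mean_le_half; rewrite -arw_d_sep.
rewrite hE; have [N1 [-> _ N1min]] := arw_t_sepP eps0.
have [N2 [-> dN2 _]] := arw_t_sepP eps0'.
have [N12|N12] := lerP (N1%:R : R) N2%:R.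
  by rewrite (@le_trans _ _ 0) ?subr_le0.
have X_ge0 : 0 <= 8 * t_rel P * h%:R / eps.
  by apply: divr_ge0 (ltW eps0); rewrite !mulr_ge0// ltW.
have devm : dev Ksub Knd nuP Kadm m finset.set0 = W by rewrite /dev subrr expr0n addr0.
have lo : N2%:R <= m -> eps * (m - N2%:R) ^+ 2 <= W.
  move=> N2m; rewrite -devm; apply: le_trans (chebyshev_filled Ksub Knd nuP Kadm _ N2m).
  rewrite ler_wpM2r ?sqr_ge0//; move: dN2; rewrite arw_d_sep /surv; lra.
have hi : m <= N1%:R -> eps * (N1%:R - m) ^+ 2 <= W.
  case: N1 N1min N12 => [|k] N1min N12 mN1; first by have := ler0n R N2; lra.
  rewrite -devm; apply: le_trans (chebyshev_surv Ksub Knd nuP Kadm _ mN1).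
  by rewrite ler_wpM2r ?sqr_ge0// ltW// -arw_d_sep N1min.
have W_ge0 : 0 <= W := var_ge0 Ksub Knd nuP Kadm _.
rewrite -(ler_pXn2r (n := 2)) ?nnegrE ?sqrtr_ge0 ?subr_ge0 ?(ltW N12)// sqr_sqrtr//.
rewrite ler_pdivlMr//.
suff : (N1%:R - N2%:R) ^+ 2 * eps <= 4 * W by nra.
move: (N1%:R : R) (N2%:R : R) lo hi N12 => a b lo hi ba.
(* With the mean [m] between [b] and [a], [(a - b)^2 <= 2 * (a - m)^2 + 2 * (m - b)^2]; otherwise a
   single deviation covers the whole window. *)
have [bm|mb] := lerP b m; have [am|ma] := lerP m a.
- have := lo bm; have := hi am; have := mulr_ge0 (ltW eps0) (sqr_ge0 ((a - m) - (m - b))).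
  nra.
- have := lo bm; have : (a - b) ^+ 2 <= (m - b) ^+ 2 by nra.
  nra.
- have := hi am; have : (a - b) ^+ 2 <= (a - m) ^+ 2 by nra.
  nra.
- by lra.
Qed.

(** The constant 32 makes the window at most [delta / 2 * t_sep]: half of [delta] leaves room for
    strict inequalities. *)
Lemma arw_cutoff_window eps delta : 0 < eps -> eps < 2^-1 -> 0 < delta ->
    t_rel P <= eps * delta ^+ 2 / 32 * t_sep P 2^-1 ->
  (forall t, t%:R <= (1 - delta) * t_sep P 2^-1 -> 1 - eps < d t) /\
  (forall t, (1 + delta) * t_sep P 2^-1 < t.+1%:R -> d t <= eps).
Proof.
move=> eps0 eps1 delta0 tr.
have win := arw_window eps0 eps1; have ts0 := arw_t_sep_gt0.
have half0 : 0 < 2^-1 :> R by rewrite invr_gt0.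
have eps0' : 0 < 1 - eps by lra.
have le1 : t_sep P 2^-1 <= t_sep P eps by apply: arw_t_sep_anti => //; exact: ltW.
have le2 : t_sep P (1 - eps) <= t_sep P 2^-1 by apply: arw_t_sep_anti => //; lra.
have {win} : t_sep P eps - t_sep P (1 - eps) <= delta / 2 * t_sep P 2^-1.
  apply: le_trans win _.
  rewrite -[leRHS]ger0_norm ?mulr_ge0 ?divr_ge0 ?(ltW ts0) ?(ltW delta0)//.
  rewrite -sqrtr_sqr ler_wsqrtr// ler_pdivrMr//.
  by nra.
move: le1 le2; have [M [-> dM _]] := arw_t_sepP eps0.
have [N [-> _ Nmin]] := arw_t_sepP eps0'.
move: (t_sep P 2^-1) ts0 tr => ts ts0 tr le1 le2 win.
have dts : 0 < delta * ts by rewrite mulr_gt0.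
split=> t tts.
  by apply: Nmin; rewrite -(ltr_nat R); nra.
apply: le_trans dM; apply: arw_d_sep_noninc.
by rewrite -ltnS -(ltr_nat R); nra.
Qed.

(** With [x = 1 / (c * t_sep)], the assumptions give [rho >= 1 - x] and [x <= 1/2], whence
    [rho >= exp (- 2 x)]; raised to a power at most [2 * t_sep] this leaves [exp (- 4 / c)]. *)
Lemma arw_d_sep_lower c : 0 < c -> 2 / c <= t_sep P 2^-1 ->
    c * t_sep P 2^-1 < t_rel P ->
  expR (- (4 / c)) <= d (Num.truncn (2 * t_sep P 2^-1)).
Proof.
move=> c0 tc tr; set ts := t_sep P 2^-1 in tc tr *; set t := Num.truncn _.
have ts0 : 0 < ts by exact: arw_t_sep_gt0.
apply: le_trans (arw_rho t).2.
have cts : 0 < c * ts by rewrite mulr_gt0.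
have x2 : (c * ts)^-1 <= 2^-1.
  by rewrite lef_pV2 ?posrE// mulrC -ler_pdivrMr.
have rho_ge1 : 1 - (c * ts)^-1 <= rho P.
  have /andP[_ r1] := rho01; rewrite lerBlDr -lerBlDl.
  rewrite -[leLHS]invrK lef_pV2 ?posrE ?invr_gt0 ?subr_gt0//; exact: ltW.
have tts : t%:R <= 2 * ts by rewrite truncn_le// mulr_ge0// ltW.
set x := (c * ts)^-1 in x2 rho_ge1.
have x0 : 0 < x by rewrite invr_gt0.
apply: (@le_trans _ _ (expR (- (2 * x)) ^+ t)).
  rewrite -expRM_natl ler_expR mulrN lerN2.
  have -> : 4 / c = 2 * ts * (2 * x) by rewrite /x; field; rewrite !gt_eqF.
  by rewrite ler_wpM2r// mulr_ge0// ltW.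
apply: lerXn2r; rewrite ?nnegrE ?expR_ge0//; first by case/andP: rho01.
apply: le_trans rho_ge1; rewrite expRN -[leLHS]mul1r ler_pdivrMr ?expR_gt0//.
have e2 := expR_ge1Dx (2 * x).
apply: (@le_trans _ _ ((1 - x) * (1 + 2 * x))); first by nra.
by rewrite ler_wpM2l//; lra.
Qed.

End ArwSeparation.

Theorem theorem2 (R : realType) :
  (forall (V : finType) (K : V -> V -> R) (lambda : R) (nu : V -> R),
     (0 < #|V|)%N -> substochastic K -> nondegenerate_kernel K -> 0 < lambda ->
     prob_distribution nu -> admissible K nu ->
     forall eps : R, 0 < eps -> eps < 2^-1 ->
     let P := arw_matrix K lambda nu in
     t_sep P eps - t_sep P (1 - eps)
       <= Num.sqrt (8 * t_rel P * t_sep P 2^-1 / eps))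
  /\
  (forall (V : nat -> finType) (K : forall n, V n -> V n -> R)
     (lambda : nat -> R) (nu : forall n, V n -> R),
     (forall n, (1 <= n)%N ->
        [/\ (0 < #|V n|)%N, substochastic (K n) /\ nondegenerate_kernel (K n),
            0 < lambda n, prob_distribution (nu n) & admissible (K n) (nu n)]) ->
     let P := fun n => arw_matrix (K n) (lambda n) (nu n) in
     let trel : nat -> R := fun n => t_rel (P n) in
     let tsep : nat -> R := fun n => t_sep (P n) 2^-1 in
     (trel =o_\oo tsep -> separation_cutoff P)
     /\ (tsep n @[n --> \oo] --> +oo ->
         separation_cutoff P -> trel =o_\oo tsep)).
Proof.
split=> [V K lambda nu V0 Ksub Knd l0 nuP Kadm eps eps0 eps1|].
  exact: arw_window.
move=> V K lambda nu hyp P trel tsep; split.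
  move=> /eqoP trts alpha alpha0; split=> alpha1; apply/cvgrPdist_le => e e0.
    pose eps := Num.min e (4^-1); pose delta := 1 - alpha.
    have delta0 : 0 < delta by rewrite subr_gt0.
    have eps0 : 0 < eps by rewrite lt_min e0 invr_gt0 /=.
    have eps1 : eps < 2^-1 by rewrite gt_min; apply/orP; right; lra.
    have k0 : 0 < eps * delta ^+ 2 / 32 by rewrite divr_gt0 ?mulr_gt0 ?exprn_gt0.
    near=> n.
    have n1 : (1 <= n)%N by near: n; exact: nbhs_infty_ge.
    have [V0 [Ksub Knd] l0 nuP Kadm] := hyp n n1.
    have tr : `|trel n| <= eps * delta ^+ 2 / 32 * `|tsep n|.
      by near: n; exact: trts.
    have ts0 : 0 < tsep n by exact: arw_t_sep_gt0.
    rewrite (gtr0_norm ts0) in tr.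
    have [lo _] := arw_cutoff_window V0 Ksub Knd l0 nuP Kadm eps0 eps1 delta0
      (le_trans (ler_norm _) tr).
    rewrite ger0_norm ?subr_ge0 ?arw_d_sep_le1// lerBlDr -lerBlDl.
    apply/ltW/(le_lt_trans _ (lo _ _)).
      by rewrite lerD2l lerN2 ge_min lexx.
    by rewrite /delta opprB addrC subrK truncn_le// mulr_ge0// ltW.
  pose eps := Num.min e (4^-1); pose delta := alpha - 1.
  have delta0 : 0 < delta by rewrite subr_gt0.
  have eps0 : 0 < eps by rewrite lt_min e0 invr_gt0 /=.
  have eps1 : eps < 2^-1 by rewrite gt_min; apply/orP; right; lra.
  have k0 : 0 < eps * delta ^+ 2 / 32 by rewrite divr_gt0 ?mulr_gt0 ?exprn_gt0.
  near=> n.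
  have n1 : (1 <= n)%N by near: n; exact: nbhs_infty_ge.
  have [V0 [Ksub Knd] l0 nuP Kadm] := hyp n n1.
  have tr : `|trel n| <= eps * delta ^+ 2 / 32 * `|tsep n|.
    by near: n; exact: trts.
  have ts0 : 0 < tsep n by exact: arw_t_sep_gt0.
  rewrite (gtr0_norm ts0) in tr.
  have [_ hi] := arw_cutoff_window V0 Ksub Knd l0 nuP Kadm eps0 eps1 delta0
    (le_trans (ler_norm _) tr).
  rewrite sub0r normrN ger0_norm ?arw_d_sep_ge0//.
  apply: (@le_trans _ _ eps); last by rewrite ge_min lexx.
  apply: hi; rewrite /delta addrC subrK.
  exact: truncnS_gt.
(* Divergence of [tsep] provides [2 / c <= tsep n]. If every [V n] is a single site,
   [t_sep = t_rel = 1], and the integer part in the definition makes cutoff hold although [t_rel] is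
   not negligible. *)
move=> tsy cut; apply/eqoP => c c0.
have [_ /(_ (ltr1n _ 2))] := cut 2 (ler0n _ 2).
move=> /cvgrPdist_lt /(_ (expR (- (4 / c))) (expR_gt0 _)) d0.
near=> n.
have n1 : (1 <= n)%N by near: n; exact: nbhs_infty_ge.
have [V0 [Ksub Knd] l0 nuP Kadm] := hyp n n1.
have ts0 : 0 < tsep n by exact: arw_t_sep_gt0.
have tr0 : 0 < trel n by exact: arw_t_rel_gt0.
rewrite (gtr0_norm ts0) (gtr0_norm tr0) leNgt; apply/negP => tr.
have tc : 2 / c <= tsep n.
  by near: n; move/cvgryPge: tsy; apply.
have := arw_d_sep_lower V0 Ksub Knd l0 nuP Kadm c0 tc tr.
rewrite leNgt => /negP; apply.
have : `|0 - d_sep (P n) (Num.truncn (2 * t_sep (P n) 2^-1))| < expR (- (4 / c)).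
  by near: n; exact: d0.
by rewrite sub0r normrN ger0_norm ?arw_d_sep_ge0.
Unshelve. all: by end_near. Qed.
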